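(* Consider temporal (undirected) graphs in the non-strict model. Given a temporal graph $\mathcal{G}=(G,\lambda)$ on $n$ vertices and with lifetime $\tau$, and a positive integer $k$, there are algorithms running in time 1. $O(k^{k\cdot\tau}\cdot n)$ that decides whether there is a temporal connected component (TCC) of $\mathcal{G}$ of size at least $k$; 2. $O(2^{k^{\tau}}\cdot n)$ that decides whether there is a closed TCC of $\mathcal{G}$ of size at least $k$; 3. $O(k^{k^2}\cdot n)$ that decides whether there is a temporal unilateral connected component (TUCC) of $\mathcal{G}$ of size at least $k$; and 4. $O(2^{k^{k}}\cdot n)$ that decides whether there is a closed TUCC of $\mathcal{G}$ of size at least $k$.
   Context: A temporal graph $\mathcal{G}=(G,\lambda)$ with lifetime $\tau$ consists of a finite undirected graph $G$ together with a function $\lambda:E(G)\to 2^{[\tau]}$, where $[\tau]=\{1,\dots,\tau\}$; the edge $e$ is available (active) exactly at the times in $\lambda(e)$. In the non-strict model, a temporal $u,v$-path is a $u,v$-path in $G$ traversing consecutive edges $e_1,\dots,e_q$ together with times $t_1\le t_2\le\dots\le t_q$ such that $t_i\in\lambda(e_i)$ for every $i$ (the trivial path from a vertex to itself is allowed). We say $u$ reaches $v$ if there is a temporal $u,v$-path. A set $X\subseteq V(G)$ is a temporal connected set if for all $u,v\in X$, $u$ reaches $v$ and $v$ reaches $u$; it is a closed temporal connected set if this holds using temporal paths all of whose vertices lie in $X$. A set $X\subseteq V(G)$ is a temporal unilateral connected set if for all $u,v\in X$, $u$ reaches $v$ or $v$ reaches $u$; it is a closed temporal unilateral connected set if this holds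 using temporal paths all of whose vertices lie in $X$. A TCC, closed TCC, TUCC, closed TUCC is an inclusion-wise maximal temporal connected set, closed temporal connected set, temporal unilateral connected set, closed temporal unilateral connected set, respectively. Its size is its number of vertices.
   Formalization: Machine and input format, unspecified in the claim, are fixed: a uniform-cost RAM reading adjacency lists of the edges active at least once, each with a table of next active times; with plain label lists or bit vectors the bounds in 3 and 4, free of τ, fail. *)

(* Defs.v *)
From mathcomp Require Import all_boot.

Set Implicit Arguments.
Unset Strict Implicit.
Unset Printing Implicit Defensive.

(* ** Temporal graphs *)

(* The vertices are the elements of 'I_n and an edge is a two-element set of
   vertices.  The set of times {1, ..., tau} is represented by 'I_tau:
   the ordinal t stands for the time t + 1.  The values of [lab] outside
   [edges] are irrelevant; [lab e] may be empty. *)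
Record tgraph (n tau : nat) := TGraph {
  edges : {set {set 'I_n}};
  edges_card2 : forall e, e \in edges -> #|e| = 2;
  lab : {set 'I_n} -> {set 'I_tau}
}.

Section TemporalGraph.

Variables (n tau : nat) (G : tgraph n tau).
Implicit Types (X Y : {set 'I_n}) (u v : 'I_n) (p : seq 'I_n).

Definition path_edges u p : seq {set 'I_n} :=
  pairmap (fun x y => [set x; y]) u p.

(* The path has vertex sequence u :: p; its i-th edge is crossed at the i-th
   time of ts.  [all2] forces ts to have as many entries as there are edges. *)
Definition temporal_path u p (ts : seq 'I_tau) : bool :=
  [&& uniq (u :: p),
      all (fun e => e \in edges G) (path_edges u p),
      sorted leq [seq val t | t <- ts] &
      all2 (fun e t => t \in lab G e) (path_edges u p) ts].

Definition reaches u v : Prop :=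
  exists p ts, temporal_path u p ts /\ last u p = v.

Definition reaches_within X u v : Prop :=
  exists p ts,
    [/\ temporal_path u p ts, last u p = v & {subset u :: p <= X}].

Definition tc_set X : Prop :=
  {in X &, forall u v, reaches u v /\ reaches v u}.

Definition closed_tc_set X : Prop :=
  {in X &, forall u v, reaches_within X u v /\ reaches_within X v u}.

Definition tuc_set X : Prop :=
  {in X &, forall u v, reaches u v \/ reaches v u}.

Definition closed_tuc_set X : Prop :=
  {in X &, forall u v, reaches_within X u v \/ reaches_within X v u}.

Definition inclusion_maximal (P : {set 'I_n} -> Prop) X : Prop :=
  P X /\ forall Y, X \subset Y -> P Y -> Y = X.

Definition TCC := inclusion_maximal tc_set.
Definition closed_TCC := inclusion_maximal closed_tc_set.
Definition TUCC := inclusion_maximal tuc_set.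
Definition closed_TUCC := inclusion_maximal closed_tuc_set.

Definition has_TCC (k : nat) : Prop := exists X, TCC X /\ k <= #|X|.
Definition has_closed_TCC (k : nat) : Prop :=
  exists X, closed_TCC X /\ k <= #|X|.
Definition has_TUCC (k : nat) : Prop := exists X, TUCC X /\ k <= #|X|.
Definition has_closed_TUCC (k : nat) : Prop :=
  exists X, closed_TUCC X /\ k <= #|X|.

End TemporalGraph.

(* ** Random access machine *)

(* Programs of a uniform-cost RAM over the natural numbers, in structured form:
   finitely many named registers and one unbounded memory with indirect
   addressing.  The only arithmetic operations are addition and truncated
   subtraction (no multiplication, as in the RAM of Cook and Reckhow); a test
   succeeds when its value is nonzero. *)
Inductive expr :=
  | Cst of nat
  | Reg of nat
  | Mem of expr
  | Add of expr & expr
  | Sub of expr & expr.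

Inductive prog :=
  | Skip
  | Assign of nat & expr
  | Store of expr & expr
  | Seq of prog & prog
  | If of expr & prog & prog
  | While of expr & prog.

Record state := State { reg : nat -> nat; mem : nat -> nat }.

Fixpoint eval (s : state) (e : expr) : nat :=
  match e with
  | Cst c => c
  | Reg r => reg s r
  | Mem e1 => mem s (eval s e1)
  | Add e1 e2 => eval s e1 + eval s e2
  | Sub e1 e2 => eval s e1 - eval s e2
  end.

Fixpoint ecost (e : expr) : nat :=
  match e with
  | Cst _ | Reg _ => 1
  | Mem e1 => (ecost e1).+1
  | Add e1 e2 | Sub e1 e2 => (ecost e1 + ecost e2).+1
  end.

Definition set_reg (s : state) (r v : nat) : state :=
  State [eta reg s with r |-> v] (mem s).

Definition set_mem (s : state) (a v : nat) : state :=
  State (reg s) [eta mem s with a |-> v].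

(* [exec c s t s']: started in s, the program c halts in s' after t steps. *)
Inductive exec : prog -> state -> nat -> state -> Prop :=
  | ExecSkip s : exec Skip s 1 s
  | ExecAssign r e s :
      exec (Assign r e) s (ecost e).+1 (set_reg s r (eval s e))
  | ExecStore a e s :
      exec (Store a e) s (ecost a + ecost e).+1
        (set_mem s (eval s a) (eval s e))
  | ExecSeq c1 c2 s1 t1 s2 t2 s3 :
      exec c1 s1 t1 s2 -> exec c2 s2 t2 s3 ->
      exec (Seq c1 c2) s1 (t1 + t2) s3
  | ExecIfTrue e c1 c2 s t s' :
      eval s e != 0 -> exec c1 s t s' ->
      exec (If e c1 c2) s (ecost e + t).+1 s'
  | ExecIfFalse e c1 c2 s t s' :
      eval s e = 0 -> exec c2 s t s' ->
      exec (If e c1 c2) s (ecost e + t).+1 s'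
  | ExecWhileFalse e c s :
      eval s e = 0 -> exec (While e c) s (ecost e).+1 s
  | ExecWhileTrue e c s1 t1 s2 t2 s3 :
      eval s1 e != 0 -> exec c s1 t1 s2 -> exec (While e c) s2 t2 s3 ->
      exec (While e c) s1 (ecost e + t1 + t2).+1 s3.

(* The input word occupies the memory from address 0 on; every other memory
   cell and every register initially holds 0. *)
Definition init (w : seq nat) : state := State (fun=> 0) (nth 0 w).

(* ** Encoding of the instances *)

Section Encoding.

Variables (n tau : nat) (G : tgraph n tau).

(* Adjacency lists contain only the edges that are active at some time: edges
   with empty label set lie on no temporal path, and listing them would add a
   term linear in their number to every running time. *)
Definition neighbours (u : 'I_n) : seq 'I_n :=
  [seq v <- enum 'I_n |
     ([set u; v] \in edges G) && (lab G [set u; v] != set0)].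

(* The first time not before t at which e is active, or tau if there is none. *)
Definition next_active (e : {set 'I_n}) (t : nat) : nat :=
  head tau [seq val s | s : 'I_tau <- enum (lab G e) & t <= s].

(* The label set of an edge is stored as the table of its function
   [next_active]; t is an active time exactly when its entry is t.  Scanning a
   list or a bit vector for the next active time is not possible in a number of
   steps independent of tau, whereas the bounds for the unilateral problems do
   not mention tau. *)
Definition arc_record (u v : 'I_n) : seq nat :=
  val v :: [seq next_active [set u; v] t | t <- iota 0 tau].

Definition vertex_block (u : 'I_n) : seq nat :=
  size (neighbours u) :: flatten [seq arc_record u v | v <- neighbours u].

Definition vertex_blocks : seq (seq nat) :=
  [seq vertex_block u | u <- enum 'I_n].

(* Cell 3 + u holds the address of the block of the vertex u, and cell 3 + n
   the first address after the input. *)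
Definition block_addresses : seq nat :=
  [seq 3 + n.+1 + sumn (take u (shape vertex_blocks)) | u <- iota 0 n.+1].

Definition encode (k : nat) : seq nat :=
  [:: n; tau; k] ++ block_addresses ++ flatten vertex_blocks.

End Encoding.

(* A single program and a single constant serve all n, tau, G and k.  The
   answer is "yes" when register 0 is nonzero on halting.  On the graph without
   vertices, where a bound of the form c * (f k tau * n) would be 0, only
   correctness is required. *)
Definition decidable_in_time_O
    (Q : forall n tau, tgraph n tau -> nat -> Prop)
    (f : nat -> nat -> nat -> nat) : Prop :=
  exists (P : prog) (c : nat),
  forall (n tau : nat) (G : tgraph n tau) (k : nat), 0 < k ->
  exists (t : nat) (s : state),
    [/\ exec P (init (encode G k)) t s,
        reg s 0 != 0 <-> Q n tau G k &
        0 < n -> t <= c * f n tau k].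

(* Main.v *)
Require Import Defs.
From mathcomp Require Import all_boot.
From mathcomp Require Import zify.
From Stdlib Require Import Classical_Prop.

(* One algorithm, with two switches, solves the four problems.  Let K be
   (k-1)^tau for TCCs and (k-1)^(k-1) for TUCCs.

   If all components of all snapshots have fewer than k vertices, then every
   vertex reaches at most (k-1)^tau vertices; and a component of a snapshot is a
   closed temporal connected set.  If all degrees are at most k-2, then every
   ball of radius k-1 has at most (k-1)^(k-1) vertices; and a vertex together
   with its neighbours is a closed temporal unilateral connected set, since of
   two edges at a vertex one can be crossed before the other.  So the answer is
   yes as soon as more than K vertices are found around some vertex.

   Otherwise a solution containing u can be sought among at most K candidates:
   the vertices reached from u for TCCs, and the ball of radius k-1 around u for
   TUCCs.  In the latter case the vertices of a temporal path with k vertices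
   already form a solution, so that only paths with fewer than k edges matter.
   Candidates and reachability are computed by the Bellman-Ford method for
   earliest arrival times.  Subsets of temporal (unilateral) connected sets are
   again of this kind, so that trying the K^(k-1) tuples of candidates that
   complete u to k vertices suffices; for the closed problems all 2^K subsets of
   the candidates are tried. *)

Set Implicit Arguments.
Unset Strict Implicit.
Unset Printing Implicit Defensive.

(** * A language of bounded loops with named arrays *)

Inductive lexp :=
  | LCst of nat
  | LReg of nat
  | LInp of lexp
  | LArr of nat & lexp
  | LAdd of lexp & lexp
  | LSub of lexp & lexp.

Inductive lprog :=
  | LSkip
  | LSet of nat & lexp
  | LPut of nat & lexp & lexp
  | LSeq of lprog & lprog
  | LIf of lexp & lprog & lprog
  | LFor of nat & lexp & lprog.

Record lstate := LState { lreg : nat -> nat; larr : nat -> nat -> nat }.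

Definition setr h r v := LState [eta lreg h with r |-> v] (larr h).
Definition seta h a i v :=
  LState (lreg h)
    (fun b => if b == a then fun x => if x == i then v else larr h a x else larr h b).

Section Semantics.

Variable w : seq nat.

(* Array [a] will occupy the addresses congruent to [a] modulo 16 after the input,
   and [LInp] reads those cells when its address is out of range. *)
Fixpoint leval (h : lstate) (e : lexp) : nat :=
  match e with
  | LCst c => c
  | LReg r => lreg h r
  | LInp e1 => let x := leval h e1 in
      if x < size w then nth 0 w x
      else larr h ((x - size w) %% 16) ((x - size w) %/ 16)
  | LArr a e1 => larr h a (leval h e1)
  | LAdd e1 e2 => leval h e1 + leval h e2
  | LSub e1 e2 => leval h e1 - leval h e2
  end.

Fixpoint denote (c : lprog) (h : lstate) : lstate :=
  match c with
  | LSkip => h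
  | LSet r e => setr h r (leval h e)
  | LPut a e1 e2 => seta h a (leval h e1) (leval h e2)
  | LSeq c1 c2 => denote c2 (denote c1 h)
  | LIf e c1 c2 => if leval h e != 0 then denote c1 h else denote c2 h
  | LFor i e c1 => iteri (leval h e) (fun j h' => denote c1 (setr h' i j)) h
  end.

Fixpoint cost (c : lprog) (h : lstate) : nat :=
  match c with
  | LSkip | LSet _ _ | LPut _ _ _ => 1
  | LSeq c1 c2 => cost c1 h + cost c2 (denote c1 h)
  | LIf e c1 c2 => (if leval h e != 0 then cost c1 h else cost c2 h).+1
  | LFor i e c1 =>
      (\sum_(j < leval h e)
         (cost c1 (setr (iteri j (fun j h' => denote c1 (setr h' i j)) h) i j)).+1).+1
  end.

End Semantics.

Fixpoint regs_written (c : lprog) : seq nat :=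
  match c with
  | LSkip | LPut _ _ _ => [::]
  | LSet r _ => [:: r]
  | LSeq c1 c2 | LIf _ c1 c2 => regs_written c1 ++ regs_written c2
  | LFor i _ c1 => i :: regs_written c1
  end.

Fixpoint arrs_written (c : lprog) : seq nat :=
  match c with
  | LSkip | LSet _ _ => [::]
  | LPut a _ _ => [:: a]
  | LSeq c1 c2 | LIf _ c1 c2 => arrs_written c1 ++ arrs_written c2
  | LFor _ _ c1 => arrs_written c1
  end.

Lemma denote_reg w c h r : r \notin regs_written c -> lreg (denote w c h) r = lreg h r.
Proof.
elim: c h => [|r0 e|a e1 e2|c1 IH1 c2 IH2|e c1 IH1 c2 IH2|i e c1 IH1] h //=.
- by rewrite inE => /negbTE ->.
- by rewrite mem_cat negb_or => /andP[h1 h2]; rewrite IH2 ?IH1.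
- rewrite mem_cat negb_or => /andP[h1 h2].
  by case: ifP; rewrite ?IH1 ?IH2.
- rewrite inE negb_or => /andP[/negbTE ri h1].
  by elim: (leval w h e) => //= N IH; rewrite IH1 //= ri.
Qed.

Lemma denote_arr w c h a : a \notin arrs_written c -> larr (denote w c h) a = larr h a.
Proof.
elim: c h => [|r0 e|b e1 e2|c1 IH1 c2 IH2|e c1 IH1 c2 IH2|i e c1 IH1] h //=.
- by rewrite inE => /negbTE ->.
- by rewrite mem_cat negb_or => /andP[h1 h2]; rewrite IH2 ?IH1.
- rewrite mem_cat negb_or => /andP[h1 h2].
  by case: ifP; rewrite ?IH1 ?IH2.
- move=> h1.
  by elim: (leval w h e) => //= N IH; rewrite IH1.
Qed.

Definition runs w c h T (Q : lstate -> Prop) := cost w c h <= T /\ Q (denote w c h).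

Lemma runs_seq w c1 c2 h T1 T2 T Q1 Q :
  runs w c1 h T1 Q1 -> (forall h1, Q1 h1 -> runs w c2 h1 T2 Q) -> T1 + T2 <= T ->
  runs w (LSeq c1 c2) h T Q.
Proof.
move=> [t1 q1] H le; have [t2 q2] := H _ q1; split => //=.
exact: leq_trans (leq_add t1 t2) le.
Qed.

Lemma runs_weak w c h T T' (Q Q' : lstate -> Prop) :
  runs w c h T Q -> T <= T' -> (forall h1, Q h1 -> Q' h1) -> runs w c h T' Q'.
Proof. by move=> [t q] lT QQ; split; [exact: leq_trans lT|exact: QQ]. Qed.

Lemma runs_if w e c1 c2 h T Q :
  (leval w h e != 0 -> runs w c1 h T Q) -> (leval w h e = 0 -> runs w c2 h T Q) ->
  runs w (LIf e c1 c2) h T.+1 Q.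
Proof.
by rewrite /runs /=; case: (leval w h e) => [|x] /= H1 H2; [exact: H2|exact: H1].
Qed.

Lemma runs_frame w c h T Q :
  runs w c h T Q ->
  runs w c h T (fun h' => [/\ Q h', forall r, r \notin regs_written c -> lreg h' r = lreg h r
     & forall a, a \notin arrs_written c -> larr h' a = larr h a]).
Proof.
by move=> [t q]; split => //; split => // *; [exact: denote_reg|exact: denote_arr].
Qed.

Lemma runs_for w i e c h T N (I : nat -> lstate -> Prop) :
  leval w h e = N -> I 0 h ->
  (forall j h', j < N ->
     (forall r, r \notin i :: regs_written c -> lreg h' r = lreg h r) ->
     (forall a, a \notin arrs_written c -> larr h' a = larr h a) ->
     I j h' -> runs w c (setr h' i j) T (I j.+1)) ->
  runs w (LFor i e c) h (N * T.+1).+1 (I N).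
Proof.
move=> eN I0 IS; rewrite /runs /= eN.
set f := fun j h' => denote w c (setr h' i j).
have key j : j <= N ->
  [/\ I j (iteri j f h),
      forall r, r \notin i :: regs_written c -> lreg (iteri j f h) r = lreg h r &
      forall a, a \notin arrs_written c -> larr (iteri j f h) a = larr h a].
  elim: j => // j IH ltj; have [Ij Fr Fa] := IH (ltnW ltj).
  have [_ Ij1] := IS j _ ltj Fr Fa Ij; split => //= r rN.
  - rewrite /f denote_reg /=; last by move: rN; rewrite inE negb_or => /andP[].
    by rewrite ifF ?Fr //; apply/negbTE; move: rN; rewrite inE negb_or => /andP[].
  - by rewrite /f denote_arr //= Fa.
split; last by have [] := key N (leqnn N).
rewrite ltnS -[N in N * _]card_ord -sum_nat_const leq_sum // => j _.
have [Ij Fr Fa] := key j (ltnW (ltn_ord j)).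
by have [] := IS j _ (ltn_ord j) Fr Fa Ij.
Qed.

(** * Compilation to the random access machine *)

Definition mul16 e :=
  let e2 := Add e e in let e4 := Add e2 e2 in let e8 := Add e4 e4 in Add e8 e8.

Fixpoint cexp (e : lexp) : expr :=
  match e with
  | LCst c => Cst c
  | LReg r => Reg r.*2
  | LInp e1 => Defs.Mem (cexp e1)
  | LArr a e1 => Defs.Mem (Add (Reg 1) (Add (mul16 (cexp e1)) (Cst a)))
  | LAdd e1 e2 => Add (cexp e1) (cexp e2)
  | LSub e1 e2 => Defs.Sub (cexp e1) (cexp e2)
  end.

(* User registers are mapped to even registers; register 1 holds the length of
   the input, and a loop at nesting depth [d] keeps its bound and its counter in
   two odd registers of its own, out of reach of its body. *)
Fixpoint comp (d : nat) (c : lprog) : prog :=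
  match c with
  | LSkip => Skip
  | LSet r e => Assign r.*2 (cexp e)
  | LPut a e1 e2 =>
      Store (Add (Reg 1) (Add (mul16 (cexp e1)) (Cst a))) (cexp e2)
  | LSeq c1 c2 => Seq (comp d c1) (comp d c2)
  | LIf e c1 c2 => If (cexp e) (comp d c1) (comp d c2)
  | LFor i e c1 =>
      let b := (d.*2).+1.*2.+1 in let j := (d.*2).+2.*2.+1 in
      Seq (Assign b (cexp e)) (Seq (Assign j (Cst 0))
        (While (Defs.Sub (Reg b) (Reg j))
           (Seq (Assign i.*2 (Reg j))
              (Seq (comp d.+1 c1) (Assign j (Add (Reg j) (Cst 1)))))))
  end.

Definition compile (c : lprog) : prog :=
  Seq (Assign 1 (Defs.Mem (Add (Cst 3) (Defs.Mem (Cst 0))))) (comp 0 c).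

Fixpoint weight (c : lprog) : nat :=
  match c with
  | LSkip => 1
  | LSet r e => (ecost (cexp e)).+1
  | LPut a e1 e2 =>
      (ecost (Add (Reg 1) (Add (mul16 (cexp e1)) (Cst a))) + ecost (cexp e2)).+1
  | LSeq c1 c2 => weight c1 + weight c2
  | LIf e c1 c2 => (ecost (cexp e)).+1 + weight c1 + weight c2
  | LFor i e c1 => (ecost (cexp e)) + 20 + weight c1
  end.

Fixpoint wfe (e : lexp) : bool :=
  match e with
  | LCst _ | LReg _ => true
  | LInp e1 => wfe e1
  | LArr a e1 => (a < 16) && wfe e1
  | LAdd e1 e2 | LSub e1 e2 => wfe e1 && wfe e2
  end.

Fixpoint wf (c : lprog) : bool :=
  match c with
  | LSkip => true
  | LSet r e => wfe e
  | LPut a e1 e2 => [&& a < 16, wfe e1 & wfe e2]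
  | LSeq c1 c2 => wf c1 && wf c2
  | LIf e c1 c2 => [&& wfe e, wf c1 & wf c2]
  | LFor i e c1 => wfe e && wf c1
  end.

Record simul (w : seq nat) (h : lstate) (s : state) : Prop := Simul {
  sim_base : reg s 1 = size w;
  sim_reg : forall r, reg s r.*2 = lreg h r;
  sim_inp : forall x, x < size w -> Defs.mem s x = nth 0 w x;
  sim_arr : forall a i, a < 16 -> Defs.mem s (size w + (16 * i + a)) = larr h a i
}.

Lemma cexpE w h s e : simul w h s -> wfe e -> eval s (cexp e) = leval w h e.
Proof.
move=> S; elim: e => [c|r|e IH|a e IH|e1 IH1 e2 IH2|e1 IH1 e2 IH2] //=.
- by move=> _; rewrite (sim_reg S).
- move=> /IH ->; case: ltnP => [/(sim_inp S)//|le].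
  rewrite -(sim_arr S _ (ltn_pmod _ (isT : 0 < 16))) mulnC -divn_eq.
  by rewrite subnKC.
- move=> /andP[a16 /IH E].
  rewrite (sim_base S) -(sim_arr S _ a16) -E; congr (Defs.mem s _); lia.
- by move=> /andP[/IH1 -> /IH2 ->].
- by move=> /andP[/IH1 -> /IH2 ->].
Qed.

Lemma simul_setr w h s r v : simul w h s -> simul w (setr h r v) (set_reg s r.*2 v).
Proof.
case=> b R I A; split=> //= [|r']; last by rewrite -R (inj_eq double_inj).
by rewrite ifF //; apply/eqP=> /(congr1 odd); rewrite odd_double.
Qed.

Lemma simul_hidden w h s r v : 0 < r -> simul w h s -> simul w h (set_reg s r.*2.+1 v).
Proof.
move=> r0 [b R I A]; split=> //= [|r'].
  by rewrite ifF //; case: r r0.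
rewrite ifF ?R //; apply/eqP=> /(congr1 odd); by rewrite /= !odd_double.
Qed.

Lemma simul_seta w h s a i v : a < 16 -> simul w h s ->
  simul w (seta h a i v) (set_mem s (size w + (16 * i + a)) v).
Proof.
move=> a16 [b R I A]; split=> //= [x lx|a' i' a'16].
  by rewrite ifF ?I //; apply/eqP; lia.
case: (a' =P a) => [->|ne] /=.
  rewrite -A //; case: (i' =P i) => [->|ne']; first by rewrite eqxx.
  by rewrite ifF //; apply/eqP; lia.
by rewrite ifF ?A //; apply/eqP; lia.
Qed.

Lemma comp_correct w c d h s : wf c -> simul w h s ->
  exists t s', [/\ exec (comp d c) s t s', t <= weight c * cost w c h,
    simul w (denote w c h) s' &
    forall r, odd r -> r < (d.*2).+1.*2.+1 -> reg s' r = reg s r].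
Proof.
elim: c d h s => [|r e|a e1 e2|c1 IH1 c2 IH2|e c1 IH1 c2 IH2|i e c1 IH1] d h s.
- move=> _ S; exists 1, s; split => //; exact: ExecSkip.
- move=> /= We S; eexists _, _; split; first exact: ExecAssign.
  + by rewrite muln1.
  + by rewrite (cexpE S) //; exact: simul_setr.
  + move=> r' ro _ /=; rewrite ifF //; apply/eqP => E.
    by move: ro; rewrite E odd_double.
- move=> /= /and3P[a16 W1 W2] S; eexists _, _; split; first exact: ExecStore.
  + by rewrite muln1.
  + rewrite (cexpE S W2) -/(mul16 (cexp e1)).
    rewrite [eval s _]/= (sim_base S).
    have -> : eval s (cexp e1) = leval w h e1 by exact: cexpE.
    have := simul_seta (leval w h e1) (leval w h e2) a16 S.
    by congr (simul _ _ (set_mem _ _ _)); lia.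
  + by [].
- move=> /= /andP[W1 W2] S.
  have [t1 [s1 [E1 T1 S1 R1]]] := IH1 d h s W1 S.
  have [t2 [s2 [E2 T2 S2 R2]]] := IH2 d _ s1 W2 S1.
  exists (t1 + t2), s2; split => //; first exact: ExecSeq E1 E2.
  + nia.
  + by move=> r ro lr; rewrite R2 ?R1.
- move=> /= /and3P[We W1 W2] S; have E := cexpE S We.
  case: (eqVneq (leval w h e) 0) => [e0|e0].
  + have [t1 [s1 [E1 T1 S1 R1]]] := IH2 d h s W2 S.
    exists (ecost (cexp e) + t1).+1, s1; split => //.
      by apply: ExecIfFalse E1; rewrite E.
      by rewrite /=; nia.
  + have [t1 [s1 [E1 T1 S1 R1]]] := IH1 d h s W1 S.
    exists (ecost (cexp e) + t1).+1, s1; split => //.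
      by apply: ExecIfTrue E1; rewrite E.
      by rewrite /=; nia.
- move=> /= /andP[We W1] S; have E := cexpE S We.
  set b := (d.*2).+1.*2.+1; set j := (d.*2).+2.*2.+1.
  set N := leval w h e in E *.
  set f := fun j h' => denote w c1 (setr h' i j).
  set body := Seq (Assign i.*2 _) _.
  have loop M m s0 : M + m = N -> simul w (iteri m f h) s0 ->
     reg s0 b = N -> reg s0 j = m ->
     exists t s', [/\ exec (While (Defs.Sub (Reg b) (Reg j)) body) s0 t s',
       t <= (20 + weight c1) *
              (\sum_(m <= x < N) (cost w c1 (setr (iteri x f h) i x)).+1) + 4,
       simul w (iteri N f h) s' &
       forall r, odd r -> r < b -> reg s' r = reg s0 r].
    elim: M m s0 => [|M IH] m s0 mN S0 rb rj.
      exists 4, s0; split => //; first by apply: ExecWhileFalse => /=; lia.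
        by rewrite leq_addl.
      by rewrite add0n in mN; rewrite -mN.
    have S0' : simul w (setr (iteri m f h) i m) (set_reg s0 i.*2 (eval s0 (Reg j))).
      by rewrite /= rj; exact: simul_setr.
    have [t1 [s1 [E1 T1 S1 R1]]] := IH1 d.+1 _ _ W1 S0'.
    have db x : x.*2.+1 == i.*2 = false.
      by apply/eqP => /(congr1 odd); rewrite /= !odd_double.
    have rb1 : reg s1 b = N.
      rewrite R1 /= ?db //; last by rewrite /b; lia.
      by rewrite odd_double.
    have rj1 : reg s1 j = m.
      by rewrite R1 /= ?db //; rewrite /j; lia.
    set s2 := set_reg s1 j (eval s1 (Add (Reg j) (Cst 1))).
    have S2 : simul w (iteri m.+1 f h) s2.
      rewrite /s2; apply: simul_hidden => //.
    have rb2 : reg s2 b = N by rewrite /= ifF //; apply/eqP; rewrite /b /j; lia.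
    have rj2 : reg s2 j = m.+1 by rewrite /= eqxx rj1 addn1.
    have mN' : M + m.+1 = N by rewrite addnS -mN addSn.
    have [t' [s' [E' T' S' R']]] := IH _ _ mN' S2 rb2 rj2.
    eexists _, s'; split.
    + apply: (ExecWhileTrue _ _ E'); first by rewrite /= rb rj; lia.
      apply: ExecSeq; first exact: ExecAssign.
      by apply: (ExecSeq E1); exact: ExecAssign.
    + rewrite big_ltn; last by lia.
      move: T1 T'; set X := \sum_(_ <= _ < _) _; set Y := cost _ _ _.
      rewrite /=; nia.
    + by [].
    + move=> r ro lr; rewrite R' //= ifF; last by apply/eqP; move: lr; rewrite /b /j; lia.
      rewrite R1 //=; last by move: lr; rewrite /b; lia.
      by rewrite ifF //; apply/eqP => er; move: ro; rewrite er odd_double.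
  set s1 := set_reg s b (eval s (cexp e)).
  set s2 := set_reg s1 j (eval s1 (Cst 0)).
  have S2 : simul w (iteri 0 f h) s2 by do 2![apply: simul_hidden => //].
  have bj : (b == j) = false by apply/eqP; rewrite /b /j; lia.
  have rb2 : reg s2 b = N by rewrite /= bj eqxx E.
  have rj2 : reg s2 j = 0 by rewrite /= eqxx.
  have [t' [s' [E' T' S' R']]] := loop N 0 s2 (addn0 N) S2 rb2 rj2.
  eexists _, s'; split.
  + apply: ExecSeq; first exact: ExecAssign.
    by apply: (ExecSeq _ E'); exact: ExecAssign.
  + move: T'; rewrite big_mkord; set X := \sum_(_ < _) _.
    rewrite /=; nia.
  + by [].
  + move=> r ro lr; rewrite R' //= !ifF //; apply/eqP; move: lr; rewrite /b /j; lia.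
Qed.

Definition linit := LState (fun=> 0) (fun _ _ => 0).

Lemma compile_correct w c : wf c -> nth 0 w (3 + nth 0 w 0) = size w ->
  exists t s, [/\ exec (compile c) (init w) t s,
    t <= (weight c + 6) * (cost w c linit).+1 &
    reg s 0 = lreg (denote w c linit) 0].
Proof.
move=> Wc base.
set s1 := set_reg (init w) 1 (eval (init w) (Defs.Mem (Add (Cst 3) (Defs.Mem (Cst 0))))).
have S1 : simul w linit s1.
  split=> //= [r|a i _]; last by rewrite nth_default // leq_addr.
  by rewrite ifF //; apply/eqP=> /(congr1 odd); rewrite odd_double.
have [t [s [E T S _]]] := comp_correct 0 Wc S1.
eexists _, s; split; first by apply: (ExecSeq _ E); exact: ExecAssign.
  by rewrite /=; nia.
exact: (sim_reg S 0).
Qed.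

(** * Reading the input *)

Definition cell (w : seq nat) x v := x < size w /\ nth 0 w x = v.

Lemma leval_inp w h e v : cell w (leval w h e) v -> leval w h (LInp e) = v.
Proof. by move=> [lx vx] /=; rewrite lx. Qed.

Lemma cell_cat w1 w2 x v : cell w2 x v -> cell (w1 ++ w2) (size w1 + x) v.
Proof.
move=> [lx vx]; split; first by rewrite size_cat ltn_add2l.
by rewrite nth_cat -{2}[size w1]addn0 ltn_add2l ltn0 addKn.
Qed.

Lemma cell_catl w1 w2 x v : cell w1 x v -> cell (w1 ++ w2) x v.
Proof. by move=> [lx vx]; split; rewrite ?size_cat ?nth_cat ?lx // ltn_addr. Qed.

Lemma cell_flatten ss i x v : cell (nth [::] ss i) x v ->
  cell (flatten ss) (sumn (take i (shape ss)) + x) v.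
Proof.
elim: ss i => [|s ss IH] [|i] /=.
- by case.
- by case.
- by move=> c; rewrite add0n; exact: cell_catl.
- by move=> /IH c; rewrite -addnA; exact: cell_cat.
Qed.

Section Encoding.

Variables (n tau : nat) (G : tgraph n tau) (k : nat).
Let w := encode G k.

Lemma size_block_addresses : size (block_addresses G) = n.+1.
Proof. by rewrite size_map size_iota. Qed.

Lemma size_blocks : size (shape (vertex_blocks G)) = n.
Proof. by rewrite size_map size_map size_enum_ord. Qed.

Lemma cell_n : cell w 0 n. Proof. by []. Qed.
Lemma cell_tau : cell w 1 tau. Proof. by []. Qed.
Lemma cell_k : cell w 2 k. Proof. by []. Qed.

Lemma cell_block_address i : i <= n ->
  cell w (3 + i) (3 + n.+1 + sumn (take i (shape (vertex_blocks G)))).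
Proof.
move=> lin; rewrite /w /encode; apply: (@cell_cat [:: n; tau; k]).
apply: cell_catl; split; rewrite ?size_block_addresses //.
by rewrite (nth_map 0) ?size_iota // nth_iota // add0n.
Qed.

Lemma encode_end : nth 0 w (3 + nth 0 w 0) = size w.
Proof.
have [_ ->] := cell_block_address (leqnn n).
rewrite -{2}size_blocks take_size /w /encode 2!size_cat size_block_addresses.
by rewrite size_flatten addnA.
Qed.

Lemma cell_block (u : 'I_n) x v : cell (vertex_block G u) x v ->
  cell w (nth 0 w (3 + u) + x) v.
Proof.
move=> c; have [_ ->] := cell_block_address (ltnW (ltn_ord u)).
have -> : w = ([:: n; tau; k] ++ block_addresses G) ++ flatten (vertex_blocks G).
  by rewrite -catA.
rewrite -addnA.
have -> : 3 + n.+1 = size ([:: n; tau; k] ++ block_addresses G).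
  by rewrite size_cat size_block_addresses.
apply: cell_cat; apply: cell_flatten.
rewrite (nth_map u) ?size_enum_ord //.
by rewrite nth_ord_enum.
Qed.

Lemma cell_deg (u : 'I_n) : cell w (nth 0 w (3 + u)) (size (neighbours G u)).
Proof. by rewrite -[X in cell _ X _]addn0; apply: cell_block. Qed.

Lemma size_arc u v : size (arc_record G u v) = tau.+1.
Proof. by rewrite /= size_map size_iota. Qed.

Lemma cell_arcs (u : 'I_n) j x y : j < size (neighbours G u) ->
  cell (arc_record G u (nth u (neighbours G u) j)) x y ->
  cell w (nth 0 w (3 + u) + 1 + j * tau.+1 + x) y.
Proof.
move=> lj c; rewrite -!addnA; apply: cell_block.
rewrite /vertex_block -cat1s; apply: (@cell_cat [:: _]).
have -> : j * tau.+1 = sumn (take j (shape [seq arc_record G u v | v <- neighbours G u])).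
  have -> : shape [seq arc_record G u v | v <- neighbours G u]
            = nseq (size (neighbours G u)) tau.+1.
    elim: (neighbours G u) => //= v s ->.
    by rewrite size_map size_iota.
  by rewrite take_nseq ?(ltnW lj) ?sumn_nseq 1?mulnC.
by apply: cell_flatten; rewrite (nth_map u).
Qed.

Lemma cell_nb (u : 'I_n) j : j < size (neighbours G u) ->
  cell w (nth 0 w (3 + u) + 1 + j * tau.+1) (nth u (neighbours G u) j).
Proof. by move=> lj; rewrite -[X in cell _ X _]addn0; apply: cell_arcs. Qed.

Lemma cell_time (u : 'I_n) j t : j < size (neighbours G u) -> t < tau ->
  cell w (nth 0 w (3 + u) + 1 + j * tau.+1 + 1 + t)
    (next_active G [set u; nth u (neighbours G u) j] t).
Proof.
move=> lj lt; rewrite -addnA; apply: cell_arcs => //.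
split; first by rewrite size_arc.
by rewrite /= (nth_map 0) ?size_iota // nth_iota.
Qed.

End Encoding.

Section NextActive.

Variables (n tau : nat) (G : tgraph n tau) (e : {set 'I_n}).

Lemma next_active_le t (s : 'I_tau) : s \in lab G e -> t <= s ->
  next_active G e t <= s.
Proof.
move=> se ts; rewrite /next_active.
have : s \in [seq s : 'I_tau <- enum (lab G e) | t <= s] by rewrite mem_filter ts mem_enum.
have : sorted (relpre (@nat_of_ord tau) ltn) [seq s : 'I_tau <- enum (lab G e) | t <= s].
  have tr : transitive (relpre (@nat_of_ord tau) ltn).
    by move=> x y z; apply: ltn_trans.
  apply: sorted_filter => //; rewrite /enum_mem; apply: sorted_filter => //.
  by rewrite -sorted_map -enumT val_enum_ord iota_ltn_sorted.
case: [seq s : 'I_tau <- enum (lab G e) | t <= s] => //= x l.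
move=> p; rewrite inE => /orP[/eqP ->//|sl].
have tr : transitive (relpre (@nat_of_ord tau) ltn).
  by move=> a b c; apply: ltn_trans.
by have /allP/(_ s sl)/ltnW := order_path_min tr p.
Qed.

Lemma next_active_lt t : next_active G e t < tau ->
  exists2 s : 'I_tau, s \in lab G e & val s = next_active G e t /\ t <= s.
Proof.
rewrite /next_active.
have : {subset [seq s : 'I_tau <- enum (lab G e) | t <= s] <= [pred s : 'I_tau | (s \in lab G e) && (t <= s)]}.
  by move=> s; rewrite mem_filter mem_enum inE andbC.
case: [seq s : 'I_tau <- enum (lab G e) | t <= s] => [|x l] /=; first by rewrite ltnn.
by move=> /(_ x (mem_head _ _)) /andP[xe tx] _; exists x.
Qed.

End NextActive.

(** * Arrival times *)

Section Arrives.

Variables (n tau : nat) (G : tgraph n tau).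
Implicit Types (X Y : {set 'I_n}) (u v x y : 'I_n).

(* A walk from [u] inside [X] with [l] edges that ends at time [t].  With
   [m = 0] its times are nondecreasing; with [m = tau] they are arbitrary, so
   that only the length of the walk matters. *)
Inductive arrives (m : nat) X u : nat -> 'I_n -> nat -> Prop :=
  | Arrives0 : arrives m X u 0 u 0
  | ArrivesS l v t x (s : 'I_tau) :
      arrives m X u l v t -> [set v; x] \in edges G ->
      s \in lab G [set v; x] -> t - m <= s -> x \in X ->
      arrives m X u l.+1 x s.

Definition within_steps r u x := exists l t, l <= r /\ arrives tau setT u l x t.

Lemma arrives_mono m m' X X' u l v t :
  m <= m' -> X \subset X' -> arrives m X u l v t -> arrives m' X' u l v t.
Proof.
move=> lm /subsetP sX; elim=> [|l1 v1 t1 x s _ IH e sl ts xX]; first exact: Arrives0.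
apply: ArrivesS IH e sl _ (sX _ xX); exact: leq_trans (leq_sub2l _ lm) ts.
Qed.

Lemma arrives_time m X u l v t : arrives m X u l v t -> t = 0 \/ t < tau.
Proof. by case=> [|*]; [left|right]. Qed.

Lemma within_stepsS r u v x : within_steps r u v -> x \in neighbours G v ->
  within_steps r.+1 u x.
Proof.
move=> [l [t [lr a]]]; rewrite mem_filter => /andP[/andP[e /set0Pn[s sl]] _].
exists l.+1, s; split => //; apply: ArrivesS (a) e sl _ (in_setT _).
by have [->|] := arrives_time a; lia.
Qed.

Lemma within_steps_mono r r' u x : r <= r' -> within_steps r u x -> within_steps r' u x.
Proof. by move=> le [l [t [lr a]]]; exists l, t; split=> //; exact: leq_trans le. Qed.

Lemma within_steps0 r u : within_steps r u u.
Proof. by exists 0, 0; split=> //; exact: Arrives0. Qed.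

End Arrives.

(** * The program *)

(* Marks in the arrays are compared with fresh values of the clock [rCk], so that
   no array ever has to be cleared.
   [rCap]: the bound K; [rR]: the number of rounds of Bellman-Ford;
   [rMsk0], [rMsk]: the parameter [m] of [arrives] for the candidates, and now;
   [rLvl]: the mark of the vertices that may be visited (0 if all may);
   [rSrc], [rLL]: source and length of the output [aL] of Bellman-Ford;
   [rCl], [rSl]: lengths of the lists [aC] of candidates and [aS] of selected
   vertices; [rB], [rM]: base and number of the digits [aD] of the enumeration;
   [rSt], [rMst]: current marks of [aS] in [aA] and of the reachability matrix.
   [aT]: arrival times; [aV]: marks of the vertices in [aL]; [aM]: the matrix,
   row by row, with the offsets of the rows in [aRow]. *)
Definition rAns := 0. Definition rN := 1. Definition rTau := 2.
Definition rK := 3. Definition rCap := 4. Definition rR := 5.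
Definition rMsk0 := 6. Definition rCk := 7. Definition rSrc := 8.
Definition rLvl := 9. Definition rMsk := 10. Definition rLL := 11.
Definition rV := 12. Definition rP := 13. Definition rD := 14.
Definition rW := 15. Definition rT := 16. Definition rTv := 17.
Definition rRd := 18. Definition rI := 19. Definition rJ := 20.
Definition rB := 21. Definition rM := 22. Definition rPw := 23.
Definition rQ := 24. Definition rI2 := 25. Definition rJ2 := 26.
Definition rCl := 27. Definition rSl := 28. Definition rSt := 29.
Definition rMst := 30. Definition rU := 31. Definition rE := 32.
Definition rX := 33. Definition rC := 34. Definition rOk := 35.
Definition rI3 := 36. Definition rJ3 := 37. Definition rX2 := 38.

Definition aL := 0. Definition aT := 1. Definition aV := 2.
Definition aA := 3. Definition aC := 4. Definition aD := 5.
Definition aS := 6. Definition aM := 7. Definition aRow := 8.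

Coercion LReg : nat >-> lexp.
Declare Scope lprog_scope.
Delimit Scope lprog_scope with L.
Bind Scope lprog_scope with lexp lprog.
Notation "a + b" := (LAdd a b) : lprog_scope.
Notation "a - b" := (LSub a b) : lprog_scope.
Notation "a =! b" := (LAdd (LSub a b) (LSub b a)) (at level 55) : lprog_scope.
Notation "a @ e" := (LArr a e) (at level 30) : lprog_scope.
Notation "r ::= e" := (LSet r e) (at level 60) : lprog_scope.
Notation "c1 ;; c2" := (LSeq c1 c2)
  (at level 70, right associativity, format "c1 ;;  c2") : lprog_scope.
Notation "# c" := (LCst c) (at level 8, format "# c") : lprog_scope.

Section Programs.

Local Open Scope lprog_scope.

Definition relax : lprog :=
  LIf (rTau - rT)
    (LIf (rLvl - aA @ rW) LSkip
      (LIf (aV @ rW =! rCk)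
        (LIf (rCap - rLL)
          (LPut aL rLL rW ;; rLL ::= rLL + #1 ;; LPut aV rW rCk ;; LPut aT rW rT)
          (rAns ::= #1))
        (LIf (aT @ rW - rT) (LPut aT rW rT) LSkip)))
    LSkip.

Definition scan_step : lprog :=
  rW ::= LInp rP ;; rT ::= LInp (rP + #1 + rTv) ;; rP ::= rP + rTau + #1 ;; relax.

Definition scan : lprog :=
  rP ::= LInp (#3 + rV) ;; rD ::= LInp rP ;; rTv ::= aT @ rV - rMsk ;;
  rP ::= rP + #1 ;; LFor rJ rD scan_step.

(* The bound of a loop is evaluated once, hence a round only scans the vertices
   that were in the list when it began, and [r] rounds stay within [r] edges. *)
Definition bf_round : lprog := LFor rI rLL (rV ::= aL @ rI ;; scan).

Definition bf : lprog :=
  rCk ::= rCk + #1 ;; LPut aL #0 rSrc ;; rLL ::= #1 ;; LPut aT rSrc #0 ;;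
  LPut aV rSrc rCk ;; LFor rRd rR bf_round.

Definition pow : lprog :=
  rPw ::= #1 ;;
  LFor rI3 rM (rQ ::= #0 ;; LFor rJ3 rB (rQ ::= rQ + rPw) ;; rPw ::= rQ).

Definition rows : lprog :=
  rMst ::= rCk + #1 ;; rCk ::= rMst ;;
  LFor rI2 rSl
    (rSrc ::= aS @ rI2 ;; bf ;;
     LFor rJ2 rLL (LPut aM (aRow @ rSrc + aL @ rJ2) rMst)).

Definition cand : lprog :=
  rSrc ::= rU ;; rLvl ::= #0 ;; rMsk ::= rMsk0 ;; bf ;;
  LFor rI3 rLL (LPut aC rI3 (aL @ rI3) ;; LPut aS rI3 (aL @ rI3)) ;;
  rCl ::= rLL ;; rSl ::= rLL ;; rMsk ::= #0.

Definition add_vertex : lprog :=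
  LIf (aA @ rX =! rSt)
    (LPut aA rX rSt ;; LPut aS rSl rX ;; rSl ::= rSl + #1) LSkip.

(* The digits select a subset of the candidates in the closed problems, and the
   vertices that accompany [rU] in the other ones. *)
Definition pick (closed : bool) : lprog :=
  if closed then
    LFor rI3 rM (LIf (aD @ rI3) (rX ::= aC @ rI3 ;; add_vertex) LSkip)
  else
    rX ::= rU ;; add_vertex ;;
    LFor rI3 rM (rX ::= aC @ (aD @ rI3) ;; add_vertex).

Definition select (closed : bool) : lprog :=
  rCk ::= rCk + #1 ;; rSt ::= rCk ;; rSl ::= #0 ;; pick closed.

Definition refute (uni : bool) : lprog :=
  LIf (aM @ (aRow @ rE + rX) =! rMst)
    (LIf (if uni then aM @ (aRow @ rX + rE) =! rMst else #1) (rOk ::= #0) LSkip)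
    LSkip.

Definition check (uni : bool) : lprog :=
  rOk ::= #1 ;;
  LFor rI3 rSl
    (rE ::= aS @ rI3 ;; LFor rJ3 rSl (rX ::= aS @ rJ3 ;; refute uni)) ;;
  LIf (rOk - (rK - rSl)) (rAns ::= #1) LSkip.

(* Adds 1 to the number with digits [aD], the least significant one first. *)
Definition next : lprog :=
  rC ::= #1 ;;
  LFor rI3 rM
    (rX ::= aD @ rI3 + rC ;;
     LIf (rX =! rB) (LPut aD rI3 rX ;; rC ::= #0) (LPut aD rI3 #0 ;; rC ::= #1)).

Definition attempt (uni closed : bool) : lprog :=
  select closed ;; (if closed then rLvl ::= rSt ;; rows else LSkip) ;;
  check uni ;; next.

Definition search (uni closed : bool) : lprog :=
  (if closed then rB ::= #2 ;; rM ::= rCl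
   else rows ;; rB ::= rCl ;; rM ::= rK - #1) ;;
  pow ;; LFor rI3 rM (LPut aD rI3 #0) ;; LFor rX2 rPw (attempt uni closed).

Definition vertex (uni closed : bool) : lprog :=
  cand ;; LIf (rCl + #1 - rK) (search uni closed) LSkip.

Definition row_table : lprog :=
  rQ ::= #0 ;; LFor rI3 rN (LPut aRow rI3 rQ ;; rQ ::= rQ + rN).

Definition degrees : lprog :=
  LFor rI3 rN (LIf (LInp (LInp (#3 + rI3)) + #1 - rCap) (rAns ::= #1) LSkip).

Definition main (uni closed : bool) : lprog :=
  rN ::= LInp #0 ;; rTau ::= LInp #1 ;; rK ::= LInp #2 ;;
  LIf (rK - #1)
    (rB ::= rK - #1 ;; rM ::= (if uni then rK - #1 else rTau) ;; pow ;;
     rCap ::= rPw ;; rR ::= (if uni then rK - #1 else rCap) ;;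
     rMsk0 ::= (if uni then LReg rTau else #0) ;; row_table ;; degrees ;;
     LIf rAns LSkip (LFor rU rN (vertex uni closed)))
    (rAns ::= rN).

End Programs.

Lemma runs_set w r e c h T Q :
  runs w c (setr h r (leval w h e)) T Q -> runs w (r ::= e ;; c)%L h T.+1 Q.
Proof. by []. Qed.

Lemma runs_put w a e1 e2 c h T Q :
  runs w c (seta h a (leval w h e1) (leval w h e2)) T Q ->
  runs w (LPut a e1 e2 ;; c)%L h T.+1 Q.
Proof. by []. Qed.

Lemma ord_eqE n (x y : 'I_n) : (nat_of_ord x == nat_of_ord y) = (x == y).
Proof. by []. Qed.

Section BellmanFord.

Variables (n tau : nat) (G : tgraph n tau) (k K R m0 : nat) (Q : Prop).
Local Notation w := (encode G k).
Implicit Types (X Y : {set 'I_n}) (u v x y : 'I_n) (L : seq 'I_n) (h : lstate).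

Definition overflow u := exists Y, K < #|Y| /\ forall x, x \in Y ->
  (exists l t, arrives G m0 setT u l x t) /\ within_steps G R u x.

Hypothesis overflowQ : forall u, overflow u -> Q.
Hypothesis degK : forall v, size (neighbours G v) <= K.

Definition rep h a r L :=
  lreg h r = size L /\
  forall i, i < size L -> larr h a i = nth 0 [seq val x | x <- L] i.

Lemma rep_nth h a r L v i : rep h a r L -> i < size L -> larr h a i = nth v L i.
Proof. by move=> [_ H] lt; rewrite H // (nth_map v). Qed.

Variables (X : {set 'I_n}) (m ck : nat) (u : 'I_n).
Hypothesis mm0 : m <= m0.

(* [d] bounds the number of edges from [u] to the vertices of [L]. *)
Record bf_inv h L d : Prop := BfInv {
  bf_tau : lreg h rTau = tau;
  bf_cap : lreg h rCap = K;
  bf_msk : lreg h rMsk = m;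
  bf_ck : lreg h rCk = ck;
  bf_lvl : forall x, (lreg h rLvl - larr h aA x == 0) = (x \in X);
  bf_rep : rep h aL rLL L;
  bf_uniq : uniq L;
  bf_size : size L <= K;
  bf_vis : forall x, (larr h aV x == ck) = (x \in L);
  bf_stamp : forall x, larr h aV x <= ck;
  bf_sound : forall x, x \in L -> exists l, arrives G m X u l x (larr h aT x);
  bf_steps : forall x, x \in L -> within_steps G d u x;
  bf_ans : lreg h rAns != 0 -> Q
}.

Definition ext h L h' L' :=
  [/\ exists L1, L' = L ++ L1,
      forall x, x \in L -> larr h' aT x <= larr h aT x &
      lreg h rAns != 0 -> lreg h' rAns != 0].

Lemma ext_refl h L : ext h L h L.
Proof. by split=> //; exists [::]; rewrite cats0. Qed.

Lemma ext_trans h1 L1 h2 L2 h3 L3 :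
  ext h1 L1 h2 L2 -> ext h2 L2 h3 L3 -> ext h1 L1 h3 L3.
Proof.
case=> [[A ->] T1 a1] [[B ->] T2 a2]; split=> [|x xL|/a1/a2//].
  by exists (A ++ B); rewrite catA.
by apply: leq_trans (T2 _ _) (T1 _ xL); rewrite mem_cat xL.
Qed.

Definition settled h L x t :=
  (x \in L /\ larr h aT x <= t) \/ lreg h rAns != 0.

Lemma settled_ext h L h' L' x t : ext h L h' L' -> settled h L x t -> settled h' L' x t.
Proof.
case=> [[A ->] T1 a1] [[xL tx]|/a1]; [left|by right].
by rewrite mem_cat xL; split => //; exact: leq_trans (T1 _ xL) tx.
Qed.

Lemma relax_runs h L d x t :
  bf_inv h L d -> d <= R -> lreg h rW = x -> lreg h rT = t ->
  (t < tau -> x \in X -> (exists l, arrives G m X u l x t) /\ within_steps G d u x) ->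
  runs w relax h 10 (fun h' => exists L', [/\ bf_inv h' L' d, ext h L h' L' &
    (t < tau -> x \in X -> settled h' L' x t)]).
Proof.
move=> I dR ex et new.
have [etau ecap emsk eck lvl rp uq sz vis stamp snd stp ans] := I.
have [eLL eL] := rp.
apply: runs_if => /= [|lt]; last first.
  split=> //=; exists L; split=> //; [exact: ext_refl|].
  by rewrite -et => lt'; lia.
rewrite etau et => lt; have {}lt : t < tau by lia.
apply: runs_if => /= [nX|].
  split=> //=; exists L; split=> //; [exact: ext_refl|].
  by rewrite -lvl -ex (negbTE nX).
rewrite ex => /eqP; rewrite lvl => xX.
have [[l xl] xd] := new lt xX.
apply: runs_if => /= [|]; rewrite ex eck.
  move=> ne; have xL : x \notin L by rewrite -vis; lia.
  apply: runs_if => /=; rewrite eLL ecap => H; last first.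
    split=> //=; exists L; split=> //=; last by right.
      split=> //= _; apply: (overflowQ (u := u)); exists [set y in x :: L]; split.
        rewrite cardsE; have /card_uniqP -> : uniq (x :: L) by rewrite /= xL.
        by rewrite /=; lia.
      move=> y; rewrite inE in_cons => /orP[/eqP ->|yL].
        by split; [exists l, t; exact: arrives_mono xl|exact: within_steps_mono xd].
      split; last exact: within_steps_mono (stp _ yL).
      by have [l' yl] := snd _ yL; exists l', (larr h aT y); exact: arrives_mono yl.
    by split=> //; exists [::]; rewrite cats0.
  do 3 apply: runs_put || apply: runs_set.
  split=> //=; exists (rcons L x).
  have Tx y : y \in L -> (nat_of_ord y == nat_of_ord x) = false.
    by move=> yL; rewrite ord_eqE; apply/eqP => E; rewrite -E yL in xL.
  split.
  - split=> //=.
    + split; first by rewrite size_rcons eLL addn1.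
      move=> i; rewrite size_rcons ltnS leq_eqVlt eLL map_rcons nth_rcons size_map.
      by case/orP => [/eqP ->|li] /=; rewrite ?eqxx ?ltnn ?li ?(ltn_eqF li) ?eL ?ex.
    + by rewrite rcons_uniq xL.
    + by rewrite size_rcons; lia.
    + move=> y; rewrite mem_rcons inE ex ord_eqE; case: (y =P x) => [->|_].
        by rewrite eck eqxx.
      by rewrite vis.
    + by move=> y; case: ifP; rewrite ?eck.
    + move=> y; rewrite mem_rcons inE ex et => /orP[/eqP ->|yL].
        by rewrite eqxx; exists l.
      by rewrite Tx //; exact: snd.
    + by move=> y; rewrite mem_rcons inE => /orP[/eqP ->|/stp].
  - split=> //=; first by exists [:: x]; rewrite cats1.
    by move=> y yL; rewrite ex Tx.
  - by move=> _ _; left; rewrite mem_rcons inE eqxx /= ex et eqxx.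
move=> E; have xL : x \in L by rewrite -vis; lia.
apply: runs_if => /=; rewrite ex et => H; last first.
  split=> //=; exists L; split=> //; first exact: ext_refl.
  by move=> _ _; left; split=> //; lia.
split=> //=; exists L; split.
- split=> //= y yL; rewrite ex et ord_eqE; case: (y =P x) => [->|_]; last exact: snd.
  by exists l.
- split=> //=; first by exists [::]; rewrite cats0.
  by move=> y yL; rewrite ex et ord_eqE; case: (y =P x) => [->|//]; lia.
- by move=> _ _; left; rewrite /= ex et eqxx.
Qed.

Lemma bf_inv_setr h L d (r v : nat) : r \notin [:: rTau; rCap; rMsk; rCk; rLvl; rLL; rAns] ->
  bf_inv h L d -> bf_inv (setr h r v) L d.
Proof.
move=> rN [? ? ? ? lvl [eLL eL] ? ? ? ? ? ? ?].
have ne r' : r' \in [:: rTau; rCap; rMsk; rCk; rLvl; rLL; rAns] -> (r' == r) = false.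
  by move=> r'L; apply/eqP=> E; rewrite -E r'L in rN.
by split=> //=; rewrite ?ne //; split; rewrite /= ?ne.
Qed.

Lemma bf_inv_mono h L d d' : d <= d' -> bf_inv h L d -> bf_inv h L d'.
Proof.
by move=> le [*]; split=> // x xL; apply: within_steps_mono le _; auto.
Qed.

Lemma scan_runs h L r v :
  bf_inv h L r.+1 -> r < R -> v \in L -> within_steps G r u v -> lreg h rV = v ->
  runs w scan h (K * 14 + 5) (fun h' => exists L',
    [/\ bf_inv h' L' r.+1, ext h L h' L' &
        forall x (s : 'I_tau), [set v; x] \in edges G -> s \in lab G [set v; x] ->
          larr h aT v - m <= s -> x \in X -> settled h' L' x s]).
Proof.
move=> I rR vL vd ev; set nb := neighbours G v.
set a := nth 0 w (3 + v); set tv := larr h aT v - m.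
rewrite addnC.
apply: runs_set; rewrite (leval_inp (v := a)); last first.
  rewrite /= ev; split=> //.
  by have [] := cell_block_address G k (ltnW (ltn_ord v)).
apply: runs_set; rewrite (leval_inp (v := size nb)); last exact: cell_deg.
do 2 apply: runs_set; rewrite /=.
set h1 := setr _ rP _.
  have I1 : bf_inv h1 L r.+1 by do 4 (apply: bf_inv_setr; first by []).  
apply: runs_weak.
- apply: (runs_for (T := 13) (N := size nb) (I := fun j h' => exists L',
    [/\ bf_inv h' L' r.+1, ext h L h' L',
        lreg h' rP = a + 1 + j * tau.+1 &
        forall i, i < j -> let x := nth v nb i in
          let t := next_active G [set v; x] tv in
          t < tau -> x \in X -> settled h' L' x t])) => //.
    by exists L; split=> //=; [split=> //; exists [::]; rewrite cats0|rewrite mul0n addn0].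
  move=> j h2 lj Fr Fa [L2 [I2 E2 P2 S2]].
  set x := nth v nb j.
  have tv0 : lreg h2 rTv = tv.
    by rewrite Fr //= ev (bf_msk I).
  have t0 : tv < tau.
    have /mem_nth : j < size nb by [].
    move=> /(_ v); rewrite mem_filter => /andP[/andP[_ /set0Pn[s _]] _].
    have [l /arrives_time[E|E]] := bf_sound I vL; rewrite /tv; last by lia.
    by rewrite E sub0n; apply: leq_ltn_trans (ltn_ord s).
  set t := next_active G [set v; x] tv.
  apply: runs_set; rewrite (leval_inp (v := x)); last by rewrite /= P2; exact: cell_nb.
  apply: runs_set; rewrite (leval_inp (v := t)); last first.
    by rewrite /= P2 tv0; exact: cell_time.
  apply: runs_set; rewrite /=.
  set h3 := setr _ rP _.
  have I3 : bf_inv h3 L2 r.+1 by do 4 (apply: bf_inv_setr; first by []).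
  have E3 : ext h2 L2 h3 L2 by split=> //; exists [::]; rewrite cats0.
  have P3 : lreg h3 rP = a + 1 + j.+1 * tau.+1.
    by rewrite /= P2 (bf_tau I2); lia.
  apply: runs_weak (runs_frame (@relax_runs h3 L2 r.+1 x t I3 rR erefl erefl _)) _ _ => //.
    move=> ltt xX; split; last first.
      by apply: within_stepsS vd _; exact: mem_nth.
    have /next_active_lt [s se [es ts]] := ltt.
    have [l vl] := bf_sound I vL; exists l.+1; rewrite /t -es.
    apply: ArrivesS vl _ se ts xX.
    by have : x \in nb by [exact: mem_nth]; rewrite mem_filter => /andP[/andP[]].
  move=> h4 [[L4 [I4 E4 S4]] Fr4 Fa4]; exists L4; split=> //.
  + exact: ext_trans (ext_trans E2 E3) E4.
  + by rewrite Fr4.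
  + move=> i; rewrite ltnS leq_eqVlt => /orP[/eqP ->|li] //=.
    move=> lt xX'; apply: settled_ext (ext_trans E3 E4) _; exact: S2.
- have := degK v; rewrite -/nb; nia.
move=> h2 [L2 [I2 E2 _ S2]]; exists L2; split=> // x s e sl ts xX.
have xnb : x \in nb.
  by rewrite mem_filter e mem_enum andbT /=; apply/set0Pn; exists s.
have := S2 (index x nb); rewrite index_mem xnb nth_index //= => /(_ isT).
have le := next_active_le sl ts.
case=> //; first by apply: leq_ltn_trans le _.
  by case=> xL tx; left; split=> //; exact: leq_trans tx le.
by right.
Qed.

Lemma bf_round_runs h L r : bf_inv h L r -> r < R ->
  runs w bf_round h (K * (K * 14 + 7)).+1 (fun h' => exists L',
    [/\ bf_inv h' L' r.+1, ext h L h' L' &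
        forall v x (s : 'I_tau), v \in L -> [set v; x] \in edges G ->
          s \in lab G [set v; x] -> larr h aT v - m <= s -> x \in X ->
          settled h' L' x s]).
Proof.
move=> I rR; apply: runs_weak.
- apply: (runs_for (T := K * 14 + 6) (N := size L) (I := fun i h' => exists L',
    [/\ bf_inv h' L' r.+1, ext h L h' L' &
        forall j x (s : 'I_tau), j < i -> let v := nth u L j in
          [set v; x] \in edges G ->
          s \in lab G [set v; x] -> larr h aT v - m <= s -> x \in X ->
          settled h' L' x s])).
  + by have [] := bf_rep I.
  + by exists L; split=> //; [exact: bf_inv_mono I|exact: ext_refl].
  move=> i h2 li _ _ [L2 [I2 E2 S2]].
  rewrite addnS; apply: runs_set; rewrite /=.
  set h3 := setr _ rV _.
  have [[L2' eL2] T2 _] := E2.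
  have I3 : bf_inv h3 L2 r.+1 by do 2 (apply: bf_inv_setr; first by []).
  have E3 : ext h2 L2 h3 L2 by split=> //; exists [::]; rewrite cats0.
  have vL : nth u L i \in L by exact: mem_nth.
  have ev : lreg h3 rV = nth u L i.
    rewrite /= (rep_nth u (bf_rep I2)) ?eL2 ?nth_cat ?li //.
    by rewrite size_cat ltn_addr.
  apply: runs_weak (scan_runs I3 rR _ (bf_steps I vL) ev) _ _ => //.
    by rewrite eL2 mem_cat vL.
  move=> h4 [L4 [I4 E4 S4]]; exists L4; split=> //.
    exact: ext_trans (ext_trans E2 E3) E4.
  move=> j x s; rewrite ltnS leq_eqVlt => /orP[/eqP -> e sl ts xX|lj e sl ts xX].
    by apply: (S4 x s e sl _ xX); apply: leq_trans ts; exact: leq_sub2r (T2 _ vL).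
  exact: settled_ext (ext_trans E3 E4) (S2 j x s lj e sl ts xX).
- by have := bf_size I; nia.
move=> h2 [L2 [I2 E2 S2]]; exists L2; split=> // v x s vL e.
have := S2 (index v L) x s; rewrite index_mem vL nth_index //= => /(_ isT e).
by apply.
Qed.

Record bf_pre h : Prop := BfPre {
  pre_tau : lreg h rTau = tau;
  pre_cap : lreg h rCap = K;
  pre_rounds : lreg h rR = R;
  pre_msk : lreg h rMsk = m;
  pre_ck : (lreg h rCk).+1 = ck;
  pre_src : lreg h rSrc = u;
  pre_lvl : forall x, (lreg h rLvl - larr h aA x == 0) = (x \in X);
  pre_stamp : forall x, larr h aV x < ck;
  pre_ans : lreg h rAns != 0 -> Q
}.

Record bf_post h h' L : Prop := BfPost {
  post_rep : rep h' aL rLL L;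
  post_uniq : uniq L;
  post_size : size L <= K;
  post_src : u \in L;
  post_sound : forall x, x \in L -> exists l t, arrives G m X u l x t;
  post_complete : forall l x t, l <= R -> arrives G m X u l x t ->
    x \in L \/ lreg h' rAns != 0;
  post_ck : lreg h' rCk = ck;
  post_stamp : forall x, larr h' aV x <= ck;
  post_ans : lreg h' rAns != 0 -> Q;
  post_ansS : lreg h rAns != 0 -> lreg h' rAns != 0
}.

Lemma bf_runs h : 0 < K -> bf_pre h ->
  runs w bf h (R * (K * (K * 14 + 7) + 2) + 6) (fun h' => exists L, bf_post h h' L).
Proof.
move=> K0 [etau ecap eR emsk eck esrc lvl stamp ans].
rewrite addnC; do 5 (apply: runs_set || apply: runs_put); rewrite /=.
set h1 := seta _ aV _ _.
have I1 : bf_inv h1 [:: u] 0.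
  split=> //=.
  - by rewrite addn1.
  - by split=> // [[|i]].
  - move=> x; rewrite inE esrc ord_eqE; case: (x =P u) => _; first by rewrite addn1 eck eqxx.
    by apply/negbTE; rewrite neq_ltn stamp.
  - by move=> x; case: ifP => _; [rewrite addn1 eck|exact: ltnW].
  - move=> x; rewrite inE => /eqP ->; exists 0; rewrite esrc eqxx; exact: Arrives0.
  - move=> x; rewrite inE => /eqP ->; exact: within_steps0.
apply: runs_weak.
- apply: (runs_for (T := (K * (K * 14 + 7)).+1) (N := R) (I := fun r h' => exists L,
    [/\ bf_inv h' L r, ext h1 [:: u] h' L &
        forall l x t, l <= r -> arrives G m X u l x t -> settled h' L x t])) => //.
    exists [:: u]; split=> //; first exact: ext_refl.
    move=> [|l] // x t _ xt.
    have : x = u /\ t = 0 by inversion xt.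
    by case=> -> ->; left; split; rewrite ?inE /= ?esrc eqxx.
  move=> r h2 rR _ _ [L2 [I2 E2 S2]].
  set h3 := setr _ rRd _.
  have I3 : bf_inv h3 L2 r by apply: bf_inv_setr.
  have E3 : ext h2 L2 h3 L2 by split=> //; exists [::]; rewrite cats0.
  apply: runs_weak (bf_round_runs I3 rR) _ _ => // h4 [L4 [I4 E4 S4]].
  exists L4; split=> //; first exact: ext_trans (ext_trans E2 E3) E4.
  move=> l x t; rewrite leq_eqVlt => /orP[/eqP ->|lr xt]; last first.
    by apply: settled_ext (ext_trans E3 E4) _; apply: S2 xt.
  move=> xt; inversion xt as [|l' v t' x' s vt e sl ts xX]; subst.
  case: (S2 _ _ _ (leqnn r) vt) => [[vL tv]|a]; last first.
    by right; case: (ext_trans E3 E4) => _ _; apply.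
  by apply: (S4 v x s vL e sl _ xX); apply: leq_trans ts; exact: leq_sub2r tv.
- by rewrite /=; lia.
move=> h2 [L [I2 [[L1 eL1] _ a2] S2]]; exists L; split.
- exact: bf_rep I2.
- exact: bf_uniq I2.
- exact: bf_size I2.
- by rewrite eL1 mem_head.
- by move=> x /(bf_sound I2) [l xt]; exists l, (larr h2 aT x).
- by move=> l x t lR /(S2 _ _ _ lR) [[]|]; [left|right].
- exact: bf_ck I2.
- exact: bf_stamp I2.
- exact: bf_ans I2.
- exact: a2.
Qed.

End BellmanFord.

Lemma pow_runs w h B m : lreg h rB = B -> lreg h rM = m ->
  runs w pow h (m * (B * 2 + 4) + 2) (fun h' => lreg h' rPw = B ^ m).
Proof.
move=> eB em; rewrite addnS; apply: runs_set; rewrite /= addn1.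
apply: runs_weak.
- apply: (runs_for (T := B * 2 + 3) (N := m)
    (I := fun i h' => lreg h' rPw = B ^ i)) => //.
  move=> i h1 li Fr Fa I1.
  rewrite addnS; apply: runs_set; rewrite /=.
  apply: (runs_seq (T1 := (B * 2).+1) (T2 := 1)
    (Q1 := fun h' => lreg h' rQ = B * B ^ i)); last 2 first.
  - by move=> h2 Q2; split=> //=; rewrite Q2 expnS.
  - by rewrite addn1 addn2.
  apply: (runs_for (T := 1) (N := B) (I := fun j h' => lreg h' rQ = j * B ^ i)) => //.
    by rewrite /= Fr.
  move=> j h2 lj Fr2 Fa2 I2; split=> //=; rewrite I2 mulSn addnC; congr (_ + _).
  by rewrite Fr2.
- by rewrite -addnS.
by [].
Qed.

Definition digit B j i := (j %/ B ^ i) %% B.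

Lemma digitS B j i : 0 < B ->
  let x := digit B j i + (B ^ i %| j.+1) in
  (x = B -> digit B j.+1 i = 0 /\ B ^ i.+1 %| j.+1) /\
  (x <> B -> digit B j.+1 i = x /\ ~~ (B ^ i.+1 %| j.+1)).
Proof.
move=> B0 /=; rewrite /digit; set q := j %/ B ^ i.
have P0 : 0 < B ^ i by rewrite expn_gt0 B0.
rewrite divnS // -/q.
case: (boolP (B ^ i %| j.+1)) => [dv|ndv] /=; last first.
  rewrite add0n addn0; have := ltn_pmod q B0; split; first by lia.
  by split=> //; apply: contra ndv => /(dvdn_trans _) -> //; rewrite expnS dvdn_mull.
have ej : j.+1 = q.+1 * B ^ i.
  by rewrite -[LHS](divnK dv) divnS // dv add1n.
have -> : (B ^ i.+1 %| j.+1) = (B %| q.+1) by rewrite ej expnS dvdn_pmul2r.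
have dvE : (B %| q.+1) = (q %% B + 1 == B).
  have -> : q.+1 = q %/ B * B + (q %% B + 1) by rewrite addnA -divn_eq addn1.
  rewrite dvdn_addr ?dvdn_mull //.
  have lt := ltn_pmod q B0.
  apply/idP/eqP => [/dvdn_leq le|->]; last exact: dvdnn.
  by have := le; rewrite addn1 => /(_ isT); lia.
rewrite add1n modnS dvE; case: eqP => e; split=> // _.
by rewrite addn1.
Qed.

Lemma digit_surj B m (d : nat -> nat) : (forall i, i < m -> d i < B) ->
  exists2 j, j < B ^ m & forall i, i < m -> digit B j i = d i.
Proof.
elim: m d => [|m IH] d dB; first by exists 0.
have B0 : 0 < B by apply: leq_ltn_trans (dB 0 isT).
have [j lj ej] := IH (fun i => d i.+1) (fun i => dB i.+1).
exists (j * B + d 0); first by rewrite expnS mulnC; have := dB 0 isT; nia.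
move=> [|i] li; rewrite /digit; first by rewrite divn1 modnMDl modn_small ?dB.
by rewrite expnS divnMA divnMDl // (divn_small (dB 0 isT)) addn0; exact: ej.
Qed.

Section Machine.

Variables (n tau : nat) (G : tgraph n tau) (k K R m0 : nat) (Q : Prop).
Local Notation w := (encode G k).
Implicit Types (X Y : {set 'I_n}) (u v x y : 'I_n) (L S C : seq 'I_n) (h : lstate).

Hypothesis overflowQ : forall u, overflow G K R m0 u -> Q.
Hypothesis degK : forall v, size (neighbours G v) <= K.
Hypothesis K0 : 0 < K.

Record glob h : Prop := Glob {
  g_n : lreg h rN = n;
  g_tau : lreg h rTau = tau;
  g_k : lreg h rK = k;
  g_cap : lreg h rCap = K;
  g_R : lreg h rR = R;
  g_m0 : lreg h rMsk0 = m0;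
  g_row : forall v, larr h aRow v = v * n;
  g_ans : lreg h rAns != 0 -> Q;
  g_V : forall x, larr h aV x <= lreg h rCk;
  g_A : forall x, larr h aA x <= lreg h rCk;
  g_M : forall i, larr h aM i <= lreg h rCk
}.

Definition glob_regs := [:: rN; rTau; rK; rCap; rR; rMsk0; rCk; rAns].
Definition glob_arrs := [:: aRow; aV; aA; aM].

Lemma glob_frame h h' :
  (forall r, r \in glob_regs -> lreg h' r = lreg h r) ->
  (forall a, a \in glob_arrs -> larr h' a = larr h a) -> glob h -> glob h'.
Proof.
move=> Fr Fa [e1 e2 e3 e4 e5 e6 row ans V A M]; split; rewrite ?Fr //.
- by move=> v; rewrite Fa.
- by move=> v; rewrite Fa.
- by move=> v; rewrite Fa.
- by move=> v; rewrite Fa.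
Qed.

Lemma glob_setr h (r v : nat) : r \notin glob_regs -> glob h -> glob (setr h r v).
Proof.
move=> rN; apply: glob_frame => //= r' r'L; rewrite ifF //.
by apply/eqP=> E; rewrite -E r'L in rN.
Qed.

Definition mono h h' := lreg h rAns != 0 -> lreg h' rAns != 0.

(* The reachability facts that the matrix of stamps records for the rows of the
   vertices of [S]. *)
Definition matrix h X S :=
  (forall v x, v \in S -> larr h aM (v * n + x) = lreg h rMst ->
     exists l t, arrives G 0 X v l x t) /\
  (forall v x l t, v \in S -> l <= R -> arrives G 0 X v l x t ->
     larr h aM (v * n + x) = lreg h rMst \/ lreg h rAns != 0).

Lemma cell_inj v x v' x' : v * n + x = v' * n + x' -> v = v' /\ x = x'.
Proof.
have n0 : 0 < n by apply: leq_ltn_trans (ltn_ord v).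
move=> E; have ev : v = v' :> nat.
  have := congr1 (fun z => z %/ n) E.
  by rewrite !divnMDl // !divn_small ?addn0.
by split; apply: val_inj => //=; move: E; rewrite ev => /addnI.
Qed.

Definition bf_time := R * (K * (K * 14 + 7) + 2) + 6.

Lemma rep_frame h h' a r L : larr h' a = larr h a -> lreg h' r = lreg h r ->
  rep h a r L -> rep h' a r L.
Proof. by move=> Ea Er [H1 H2]; split; rewrite ?Er ?Ea. Qed.

Lemma glob_bf h h' X m u ck L :
  glob h -> bf_post G K R Q X m ck u h h' L -> lreg h rCk <= ck ->
  (forall r, r \notin regs_written bf -> lreg h' r = lreg h r) ->
  (forall a, a \notin arrs_written bf -> larr h' a = larr h a) -> glob h'.
Proof.
move=> g [rp uq sz _ snd cmp eck stamp ans ansS] lck Fr Fa; case: g => *.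
split; rewrite ?eck // ?Fr //.
- by move=> v; rewrite Fa.
- by move=> x; rewrite Fa //; exact: leq_trans lck.
- by move=> i; rewrite Fa //; exact: leq_trans lck.
Qed.

Lemma rows_runs h S X s :
  glob h -> rep h aS rSl S -> size S <= s -> lreg h rMsk = 0 ->
  (forall x, (lreg h rLvl - larr h aA x == 0) = (x \in X)) ->
  runs w rows h (s * (bf_time + K * 2 + 3) + 3) (fun h' =>
    [/\ glob h', matrix h' X S & mono h h']).
Proof.
move=> g rp sz emsk lvl; rewrite !addnS addn0; do 2 apply: runs_set; rewrite /=.
set mst := lreg h rCk + 1.
set h1 := setr _ rCk _.
have g1 : glob h1.
  case: g => *; split=> //= *; rewrite /mst; 
  by apply: leq_trans (leq_addr _ _).
apply: runs_weak.
- apply: runs_frame; apply: (runs_for (T := bf_time + K * 2 + 2) (N := size S) (I := fun i h' =>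
    [/\ glob h', mono h h', mst <= lreg h' rCk,
      (forall v x, larr h' aM (v * n + x) = mst ->
         v \in take i S /\ exists l t, arrives G 0 X v l x t) &
      (forall v x l t, v \in take i S -> l <= R -> arrives G 0 X v l x t ->
        larr h' aM (v * n + x) = mst \/ lreg h' rAns != 0)])).
  + by case: rp.
  + split=> //; rewrite ?take0 //.
    by move=> v x /= E; have := g_M g (v * n + x); rewrite E /mst addn1 ltnn.
  move=> i h2 li Fr Fa [g2 mo2 ck2 snd2 cmp2].
  have [u0 _] : exists u0 : 'I_n, true by case: (S) li => // u0 *; exists u0.
  set u := nth u0 S i.
  rewrite !addnS addn0; apply: runs_set.
  set h3 := setr _ rSrc _.
  have eu : lreg h3 rSrc = u.
    by rewrite /= Fa // (rep_nth u0 rp).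
  have g3 : glob h3 by do 2 (apply: glob_setr; first by []).
  have pre : bf_pre tau K R Q X 0 (lreg h3 rCk).+1 u h3.
    case: g3 => e1 e2 e3 e4 e5 e6 e7 e8 e9 e10 e11; split=> //.
    + by rewrite /= Fr.
    + by move=> x; rewrite -lvl /= Fr ?Fa.
  have BF := runs_frame (bf_runs k overflowQ degK (leq0n m0) K0 pre).
  refine (runs_seq (T2 := (K * 2).+1) BF _ _); last first.
    by rewrite /bf_time; lia.
  move=> h4 [[L P4] Fr4 Fa4].
  have g4 := glob_bf g3 P4 (leqnSn _) Fr4 Fa4.
  have ck4 := post_ck P4.
  have [rLL rL] := post_rep P4.
  have mo4 : mono h h4 by move=> /mo2 a2; apply: (post_ansS P4); rewrite /=.
  have M4 : larr h4 aM = larr h2 aM by rewrite Fa4.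
  have mst4 : lreg h4 rMst = mst by rewrite Fr4 //= Fr.
  have takeS v : (v \in take i.+1 S) = (v == u) || (v \in take i S).
    by rewrite (take_nth u0) // mem_rcons inE.
  apply: runs_weak.
  + apply: (runs_for (T := 1) (N := size L) (I := fun j h' =>
      [/\ glob h', lreg h' rCk = lreg h4 rCk, lreg h' rAns = lreg h4 rAns &
       forall a, larr h' aM a = 
         if a \in [seq u * n + val x | x <- take j L] then mst else larr h2 aM a])) => //.
    * by rewrite take0 M4; split.
    move=> j h5 lj Fr5 Fa5 [g5 ck5 ans5 M5].
    have eL : larr h5 aL j = nth u0 L j by rewrite Fa5 // (rep_nth u0 (post_rep P4)).
    have eR : larr h5 aRow (lreg h5 rSrc) = u * n.
      by rewrite Fr5 // Fr4 // eu (g_row g5).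
    have em : lreg h5 rMst = mst by rewrite Fr5.
    split=> //=; rewrite eL eR em; split=> //.
    * case: (g5) => *; split=> //= a; case: ifP => // _.
      rewrite Fr5 // ck4; apply: leq_trans ck2 _; exact: leqnSn.
    * move=> a /=; rewrite (take_nth u0) // map_rcons mem_rcons inE M5.
      by case: eqP.
  + have := post_size P4; lia.
  move=> h5 [g5 ck5 ans5 M5]; rewrite take_size in M5.
  split=> //.
  + by move=> /mo4; rewrite ans5.
  + by rewrite ck5 ck4; apply: leq_trans ck2 _; exact: leqnSn.
  + move=> v x; rewrite M5 takeS; case: ifP => [/mapP[y yL /cell_inj[-> ->]] _|_ E].
      by rewrite eqxx; split=> //; exact: (post_sound P4).
    by have [-> H] := snd2 v x E; rewrite orbT.
  + move=> v x l t; rewrite takeS => vS lR xt; rewrite M5 ans5.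
    case: ifP => [_|/negbT nM]; first by left.
    case/orP: vS => [/eqP ev|vS].
      subst v; case: (post_complete P4 lR xt) => [xL|a]; last by right.
      by case/mapP: nM; exists x.
    by case: (cmp2 v x l t vS lR xt) => [->|a]; [left|right; apply: (post_ansS P4)].
- by rewrite ltnS; apply: leq_mul => //; rewrite !addnS.
move=> h2 [[g2 mo2 ck2 snd2 cmp2] Fr Fa].
have em : lreg h2 rMst = mst by rewrite Fr.
rewrite take_size in snd2 cmp2; split=> //; split.
- by move=> v x vS; rewrite em => /snd2[].
- by rewrite em.
Qed.

Definition cand_time := bf_time + K * 3 + 7.

Lemma cand_runs h u : glob h -> lreg h rU = u ->
  runs w cand h cand_time (fun h' => exists C,
    [/\ glob h', rep h' aC rCl C, rep h' aS rSl C, [/\ size C <= K, uniq C & u \in C] &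
     [/\ forall l x t, l <= R -> arrives G m0 setT u l x t ->
           x \in C \/ lreg h' rAns != 0,
         lreg h' rMsk = 0, lreg h' rLvl = 0 & mono h h']]).
Proof.
move=> g eu; rewrite /cand_time addnC; do 3 apply: runs_set; rewrite /=.
set h1 := setr _ rMsk _.
have g1 : glob h1 by do 3 (apply: glob_setr; first by []).
have pre : bf_pre tau K R Q setT m0 (lreg h1 rCk).+1 u h1.
  case: g1 => e1 e2 e3 e4 e5 e6 e7 e8 e9 e10 e11; split=> //.
    by move=> x; rewrite /= sub0n inE.
have BF := runs_frame (bf_runs k overflowQ degK (leqnn m0) K0 pre).
refine (runs_seq (T2 := (K * 3).+1 + 3) BF _ _); last by rewrite /bf_time; lia.
move=> h2 [[L P2] Fr2 Fa2].
have g2 := glob_bf g1 P2 (leqnSn _) Fr2 Fa2.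
have rp := post_rep P2; have [eLL eL] := rp.
apply: (runs_seq (T1 := (K * 3).+1) (T2 := 3)); last by [].
  apply: runs_weak.
  - apply: runs_frame; apply: (runs_for (T := 2) (N := size L) (I := fun i h' =>
      forall j, j < i -> larr h' aC j = larr h2 aL j /\ larr h' aS j = larr h2 aL j)) => //.
    move=> i h3 li Fr3 Fa3 I3; split=> //= j; rewrite ltnS leq_eqVlt !(Fa3 aL) //.
    by case: eqP => [->|_ /= /I3].
  - have := post_size P2; lia.
  - by move=> h3 H; exact: H.
move=> h3 [I3 Fr3 Fa3]; split=> //=; exists L; split.
- do 3 (apply: glob_setr; first by []).
  apply: glob_frame g2 => [r|a].
    by rewrite !inE => /or4P[|||/or4P[|||/orP[]]] /eqP -> //; rewrite Fr3.
  by rewrite !inE => /or4P[] /eqP ->; rewrite Fa3.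
- split; first by rewrite /= Fr3.
  by move=> i li; rewrite /= (I3 i li).1 eL.
- split; first by rewrite /= Fr3.
  by move=> i li; rewrite /= (I3 i li).2 eL.
- by split; [exact: post_size P2|exact: post_uniq P2|exact: post_src P2].
split=> //=; rewrite ?Fr3 //.
- exact: (post_complete P2).
- by rewrite Fr2.
- by move=> a; rewrite /= Fr3 //; exact: (post_ansS P2).
Qed.

(** * Enumeration of vertex sets *)

Definition picks (closed : bool) u C m (d : nat -> nat) :=
  if closed then [seq nth u C i | i <- iota 0 m & d i != 0]
  else u :: [seq nth u C (d i) | i <- iota 0 m].

Record selected st (P : seq 'I_n) s h : Prop := Selected {
  sel_glob : glob h;
  sel_st : lreg h rSt = st;
  sel_ck : lreg h rCk = st;
  sel_set : exists S, [/\ rep h aS rSl S, uniq S, size S <= s, S =i P &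
    forall x, (larr h aA x == st) = (x \in S)]
}.

Lemma selected_setr st P s h (r v : nat) :
  r \notin [:: rSt, rSl & glob_regs] -> selected st P s h -> selected st P s (setr h r v).
Proof.
rewrite 2!in_cons 2!negb_or => /and3P[/negbTE r1 /negbTE r2 r3] [g e1 e2 [S [[eS rp] *]]].
split=> /=; first by apply: glob_setr.
- by rewrite eq_sym r1.
- rewrite ifF //; apply/eqP => E; by rewrite -E in r3.
- by exists S; split=> //; split=> //=; rewrite eq_sym r2.
Qed.

Lemma add_runs st P s h x : selected st P s h -> lreg h rX = x ->
  runs w add_vertex h 4 (selected st (x :: P) s.+1).
Proof.
case=> g est eck [S [rp uS sS SP AS]] ex.
apply: runs_if => /=; rewrite ex est => H.
  have xS : x \notin S by rewrite -AS; lia.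
  split=> //=; split=> //=.
  - case: g => *; split=> //= y; case: ifP => // _.
    by rewrite est eck.
  - exists (rcons S x); split.
    + have [eSl eS] := rp; split; first by rewrite /= size_rcons eSl addn1.
      move=> i; rewrite /= size_rcons ltnS leq_eqVlt eSl map_rcons nth_rcons size_map.
      by case/orP => [/eqP ->|li] /=; rewrite ?eqxx ?ltnn ?li ?(ltn_eqF li) ?eS ?ex.
    + by rewrite rcons_uniq xS.
    + by rewrite size_rcons.
    + by move=> y; rewrite mem_rcons !inE SP.
    + move=> y; rewrite mem_rcons inE /= ex ord_eqE est.
      by case: (y =P x) => [->|_]; rewrite ?eqxx.
have xS : x \in S by rewrite -AS; lia.
split=> //=; split=> //; exists S; split=> //; first exact: leqW.
by move=> y; rewrite inE -SP; case: (y =P x) => [->|].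
Qed.

Definition select_time s := s * 7 + 14.

Lemma select_runs (closed : bool) h C u m (d : nat -> nat) s :
  glob h -> rep h aC rCl C -> lreg h rM = m -> lreg h rU = u ->
  (forall i, i < m -> larr h aD i = d i) ->
  (closed -> m = size C /\ m <= s) ->
  (~~ closed -> (forall i, i < m -> d i < size C) /\ m < s) ->
  runs w (select closed) h (select_time s)
    (selected (lreg h rCk).+1 (picks closed u C m d) s).
Proof.
move=> g rp em eu eD cl ncl; rewrite /select_time addnC.
do 3 apply: runs_set; rewrite /=.
set st := (lreg h rCk).+1; set h1 := setr _ rSl _.
have s1 : selected st [::] 0 h1.
  split=> /=; rewrite ?addn1 //.
    case: g => *; split=> //= y; rewrite addn1; exact: leqW.
  exists [::]; split=> //.
  move=> x; rewrite [RHS]in_nil /=; apply/negbTE; rewrite neq_ltn.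
  by apply/orP; left; rewrite ltnS; exact: g_A.
rewrite /pick /picks; case: closed cl ncl => [/(_ isT)[mC ms] _|_ /(_ isT)[dC ms]].
  have [P PE] : exists P, P = fun j => [seq nth u C i | i <- iota 0 j & d i != 0].
    by eexists.
  have PS i : P i.+1 = if d i != 0 then rcons (P i) (nth u C i) else P i.
    rewrite PE -addn1 iotaD filter_cat map_cat /=; case: ifP => _.
      by rewrite cats1.
    by rewrite cats0.
  apply: runs_weak.
  - apply: (runs_for (T := 6) (N := m) (I := fun i h' => selected st (P i) i h')) => //.
      by rewrite PE.
    move=> i h2 li Fr Fa I2; rewrite PS; apply: runs_if => /=; rewrite Fa //= eD // => H.
      rewrite H; apply: runs_set; rewrite /=.
      have ex : lreg (setr (setr h2 rI3 i) rX (larr h2 aC i)) rX = nth u C i.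
        by rewrite /= Fa //= (rep_nth u rp) // -mC.
      apply: runs_weak (add_runs _ ex) (leqnn _) _.
        do 2 (apply: selected_setr; first by []); exact: I2.
      move=> h3 [g3 e1 e2 [S [r1 r2 r3 r4 r5]]]; split=> //; exists S; split=> //.
      by move=> x; rewrite r4 mem_rcons.
    split=> //; rewrite H /=; apply: selected_setr => //.
    case: I2 => g2 e1 e2 [S [r1 r2 r3 r4 r5]]; split=> //; exists S; split=> //.
    exact: leqW.
  - by lia.
  move=> h2 [g2 e1 e2 [S [r1 r2 r3 r4 r5]]]; split=> //; exists S; split=> //.
    exact: leq_trans ms.
  by move=> x; rewrite r4 PE.
apply: runs_set; rewrite /=.
refine (runs_seq (T1 := 4) (T2 := (m * 6).+1) _ _ _); last by lia.
  by apply: runs_frame; apply: (add_runs (P := [::]) (s := 0) (x := u)) => //; apply: selected_setr s1.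
move=> h2 [s2 Fr2 Fa2].
apply: runs_weak.
- apply: (runs_for (T := 5) (N := m) (I := fun i h' =>
    selected st (u :: [seq nth u C (d j) | j <- iota 0 i]) i.+1 h')) => //.
    by rewrite /= Fr2.
  move=> i h3 li Fr Fa I3; apply: runs_set; rewrite [leval _ _ _]/=.
  have ex : lreg (setr (setr h3 rI3 i) rX (larr h3 aC (larr h3 aD i))) rX
            = nth u C (d i).
    by rewrite [LHS]/= !Fa // !Fa2 //= eD // (rep_nth u rp) // dC.
  apply: runs_weak (add_runs _ ex) (leqnn _) _.
    do 2 (apply: selected_setr; first by []); exact: I3.
  move=> h4 [g3 e1 e2 [S [r1 r2 r3 r4 r5]]]; split=> //; exists S; split=> //.
  move=> x; rewrite r4 -[in RHS]addn1 iotaD map_cat !in_cons mem_cat !in_cons in_nil.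
  by rewrite orbF add0n orbCA; congr orb; exact: orbC.
- by lia.
move=> h3 [g2 e1 e2 [S [r1 r2 r3 r4 r5]]]; split=> //; exists S; split=> //.
exact: leq_trans ms.
Qed.

Definition linked (uni : bool) h v x :=
  let e v x := larr h aM (v * n + x) == lreg h rMst in
  if uni then e v x || e x v else e v x.

Lemma refute_runs uni h v x : glob h -> lreg h rE = v -> lreg h rX = x ->
  runs w (refute uni) h 3 (fun h' =>
    lreg h' rOk = if linked uni h v x then lreg h rOk else 0).
Proof.
move=> g ev ex; rewrite /linked.
have eqE a b : (a - b + (b - a) == 0) = (a == b) by apply/eqP/eqP; lia.
split.
  by rewrite /refute /=; case: ifP => _ //; case: (uni) => //=; case: ifP.
rewrite /= ev ex !(g_row g) !eqE; case: eqP => _ /=.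
  by case: uni.
case: uni => //=; rewrite ev ex !(g_row g) !eqE.
by case: eqP.
Qed.

Definition check_time s := s * (s * 5 + 3) + 4.

Lemma glob_ans h h' :
  (forall r, r \in glob_regs -> r != rAns -> lreg h' r = lreg h r) ->
  (forall a, a \in glob_arrs -> larr h' a = larr h a) ->
  (lreg h' rAns != 0 -> Q) -> glob h -> glob h'.
Proof.
move=> Fr Fa aQ [e1 e2 e3 e4 e5 e6 row ans V A M]; split=> //; rewrite ?Fr //.
- by move=> v; rewrite Fa.
- by move=> v; rewrite Fa.
- by move=> v; rewrite Fa.
- by move=> v; rewrite Fa.
Qed.

Lemma check_runs uni h S s : glob h -> rep h aS rSl S -> size S <= s ->
  runs w (check uni) h (check_time s) (fun h' =>
    lreg h' rAns = if allrel (linked uni h) S S && (k <= size S) then 1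
                   else lreg h rAns).
Proof.
move=> g rp sz; rewrite /check_time addnS; apply: runs_set; rewrite /=.
set h1 := setr _ rOk _.
have eS : lreg h rSl = size S by case: rp.
have lk h2 : larr h2 aM = larr h aM -> lreg h2 rMst = lreg h rMst ->
    linked uni h2 = linked uni h.
  by rewrite /linked => -> ->.
refine (runs_seq (T1 := (size S * (size S * 5 + 2).+1).+1) (T2 := 2) _ _ _); last 1 first.
- by have := leq_mul sz sz; nia.
- apply: runs_frame; apply: (runs_for (T := size S * 5 + 2) (N := size S) (I := fun i h' =>
    lreg h' rOk = allrel (linked uni h) (take i S) S)).
  + by [].
  + by rewrite take0.
  move=> i h2 li Fr Fa I2.
  have [u0 _] : exists u0 : 'I_n, true by case: (S) li => // u0 *; exists u0.
  rewrite addnS; apply: runs_set; rewrite [leval _ _ _]/=.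
  set h3 := setr _ rE _.
  have eE : lreg h3 rE = nth u0 S i by rewrite /= Fa // /h1 /= (rep_nth u0 rp).
  have -> : size S * 5 + 1 = (size S * 5).+1 by rewrite addn1.
  apply: runs_weak (leqnn _) _.
    apply: (runs_for (T := 4) (N := size S) (I := fun j h' => lreg h' rOk =
      allrel (linked uni h) (take i S) S && all (linked uni h (nth u0 S i)) (take j S))).
    + by rewrite /= Fr.
    + by rewrite take0 andbT.
    move=> j h4 lj Fr4 Fa4 I4; apply: runs_set; rewrite [leval _ _ _]/=.
    set h5 := setr _ rX _.
    have eX : lreg h5 rX = nth u0 S j by rewrite /= Fa4 // /h3 /= Fa // /h1 /= (rep_nth u0 rp).
    have g5 : glob h5.
      do 2 (apply: glob_setr; first by []).
      apply: glob_frame g => [r|a].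
        by rewrite !inE => /or4P[|||/or4P[|||/orP[]]] /eqP -> //; rewrite Fr4 // /h3 /= Fr.
      by rewrite !inE => /or4P[] /eqP ->; rewrite Fa4 // /h3 /= Fa.
    have eE5 : lreg h5 rE = nth u0 S i by rewrite /= Fr4.
    apply: runs_weak (refute_runs uni g5 eE5 eX) (leqnn _) _ => h6 ->.
    have -> : linked uni h5 = linked uni h.
      by apply: lk; rewrite /= ?Fa4 ?Fr4 // /h3 /= ?Fa ?Fr.
    rewrite (take_nth u0) // all_rcons [lreg h5 rOk]I4.
    by case: (linked uni h _ _); rewrite /= ?andbF.
  move=> h6 ->; rewrite take_size (take_nth u0) //.
  by rewrite -cats1 allrel_catl allrel1l.
move=> h2 [I2 Fr Fa]; rewrite take_size in I2.
split=> /=; first by case: ifP.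
rewrite I2 !(Fr rK, Fr rSl) // /h1 /= (g_k g) eS.
have e0 : lreg h2 rAns = lreg h rAns by rewrite Fr.
case: (allrel _ _ _) => /=; case: (leqP k (size S)) => H //.
- by have -> : k - size S = 0 by lia.
- by have -> : 1 - (k - size S) = 0 by lia.
Qed.

Definition next_time s := s * 5 + 2.

Lemma next_runs h B m j : 0 < B -> lreg h rB = B -> lreg h rM = m ->
  (forall i, i < m -> larr h aD i = digit B j i) ->
  runs w next h (next_time m) (fun h' => forall i, i < m -> larr h' aD i = digit B j.+1 i).
Proof.
move=> B0 eB em eD; rewrite /next_time addnS; apply: runs_set; rewrite /= addn1.
apply: runs_weak (leqnn _) _.
  apply: (runs_for (T := 4) (N := m) (I := fun i h' =>
    [/\ lreg h' rC = (B ^ i %| j.+1),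
        forall i', i' < i -> larr h' aD i' = digit B j.+1 i' &
        forall i', i <= i' -> larr h' aD i' = larr h aD i'])) => //.
    by split=> //; rewrite /= dvd1n.
  move=> i h2 li Fr Fa [I1 I2 I3]; apply: runs_set; rewrite [leval _ _ _]/=.
  set h3 := setr _ rX _.
  have [e1 e2] := digitS j i B0.
  have eX : larr h2 aD i + lreg h2 rC = digit B j i + (B ^ i %| j.+1).
    by rewrite I3 // eD // I1.
  have eB3 : lreg h2 rB = B by rewrite Fr.
  apply: runs_if => /=; rewrite eX eB3 => H.
    have {e1 e2} [] := e2 _; first by lia.
    move=> ed nd; split=> //=; split.
    - by rewrite (negbTE nd).
    - move=> i'; rewrite ltnS leq_eqVlt.
      by case: eqP => [->|_ /= /I2 //]; rewrite ed eX.
    - by move=> i' li'; rewrite gtn_eqF // I3 // ltnW.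
  have {e1 e2} [] := e1 _; first by lia.
  move=> ed nd; split=> //=; split.
  - by rewrite nd.
  - move=> i'; rewrite ltnS leq_eqVlt.
    by case: eqP => [->|_ /= /I2 //]; rewrite ed.
  - by move=> i' li'; rewrite gtn_eqF // I3 // ltnW.
by move=> h2 [].
Qed.

Variables (uni closed : bool).

Definition dom (P : seq 'I_n) := if closed then [set x in P] else setT.

Definition linkable (E : 'I_n -> 'I_n -> Prop) x y := if uni then E x y \/ E y x else E x y.

Definition reach_pair X := linkable (fun x y => exists l t, arrives G 0 X x l y t).

Definition short_pair X :=
  linkable (fun x y => exists l t, l <= R /\ arrives G 0 X x l y t).

Hypothesis foundQ : forall P, uniq P -> k <= size P ->
  (forall x y, x \in P -> y \in P -> reach_pair (dom P) x y) -> Q.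

Record ready u C B m h : Prop := Ready {
  rd_glob : glob h;
  rd_C : rep h aC rCl C;
  rd_u : lreg h rU = u;
  rd_B : lreg h rB = B;
  rd_m : lreg h rM = m;
  rd_msk : lreg h rMsk = 0;
  rd_matrix : ~~ closed -> matrix h setT C
}.

Lemma regs_written_select r :
  r \notin [:: rCk; rSt; rSl; rX; rI3] -> r \notin regs_written (select closed).
Proof.
rewrite !inE !negb_or => /and5P[h1 h2 h3 h4 h5].
by case: closed; rewrite /= !inE !negb_or h1 h2 h3 h4 h5.
Qed.

Lemma arrs_written_select a : a \notin [:: aA; aS] -> a \notin arrs_written (select closed).
Proof.
rewrite !inE !negb_or => /andP[h1 h2].
by case: closed; rewrite /= !inE !negb_or h1 h2.
Qed.

Lemma eq_dom P P' : P =i P' -> dom P = dom P'.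
Proof.
by move=> E; rewrite /dom; case: closed => //; apply/setP => x; rewrite !inE E.
Qed.

Lemma linked_reach h X S x y : matrix h X S -> x \in S -> y \in S ->
  linked uni h x y -> reach_pair X x y.
Proof.
move=> [snd _] xS yS; rewrite /linked /reach_pair /linkable.
by case: uni => [/orP[/eqP e|/eqP e]|/eqP e]; [left|right|]; exact: snd e.
Qed.

Lemma short_linked h X S x y : matrix h X S -> x \in S -> y \in S ->
  short_pair X x y -> linked uni h x y \/ lreg h rAns != 0.
Proof.
move=> [_ cmp] xS yS; rewrite /linked /short_pair /linkable.
have H v z : v \in S -> (exists l t, l <= R /\ arrives G 0 X v l z t) ->
    (larr h aM (v * n + z) == lreg h rMst) \/ lreg h rAns != 0.
  by move=> vS [l [t [lR a]]]; case: (cmp v z l t vS lR a) => [->|]; [left|right].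
case: uni => [[/H|/H]|/H].
- by case=> // [->|]; [left|right].
- by case=> // [->|]; [left; rewrite orbT|right].
by case=> // [->|]; [left|right].
Qed.

Definition bound := if closed then K else k.
Definition rows_time := K * (bf_time + K * 2 + 3) + 3.
Definition attempt_time := select_time bound + (if closed then rows_time else 0)
  + check_time bound + next_time bound + 1.

Lemma picks_sub u C m (d : nat -> nat) : u \in C ->
  (closed -> m = size C) -> (~~ closed -> forall i, i < m -> d i < size C) ->
  {subset picks closed u C m d <= C}.
Proof.
move=> uC cl ncl x; rewrite /picks; case: closed cl ncl => [/(_ isT) -> _|_ /(_ isT) dC].
  by case/mapP=> i; rewrite mem_filter mem_iota => /andP[_ /= li] ->; exact: mem_nth.
rewrite inE => /orP[/eqP -> //|/mapP[i]].
by rewrite mem_iota => /andP[_ /= li] ->; apply: mem_nth; exact: dC.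
Qed.

Lemma middle_runs u C B m st P h :
  selected st P bound h -> ready u C B m h -> {subset P <= C} -> size C <= K ->
  runs w (if closed then rLvl ::= rSt ;; rows else LSkip)%L h
    (if closed then rows_time else 0).+1
    (fun h' => [/\ ready u C B m h', mono h h' &
       exists S, [/\ rep h' aS rSl S, uniq S, size S <= bound, S =i P &
         matrix h' (dom S) S]]).
Proof.
rewrite /bound /dom => -[g est eck [S [rp uS sS SP AS]]] rd sub sC.
have subS x : x \in S -> x \in C by rewrite SP; exact: sub.
case: ifP sS rd => [cl sS rd|cl sS rd]; last first.
  split=> //=; split=> //; exists S; split=> //.
  have [snd cmp] := rd_matrix rd (negbT cl).
  by split=> [v x /subS|v x l t /subS]; [exact: snd|exact: cmp].
apply: runs_set; rewrite /=.
set h1 := setr _ rLvl _.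
have g1 : glob h1 by apply: glob_setr.
have lvl x : (lreg h1 rLvl - larr h1 aA x == 0) = (x \in [set y in S]).
  by rewrite /= inE -AS est; have := g_A g x; rewrite eck; case: eqP; case: eqP; lia.
have := runs_frame (rows_runs (s := K) g1 rp sS (rd_msk rd) lvl).
move/runs_weak; apply=> // h2 [[g2 M2 mo2] Fr2 Fa2]; split=> //.
  case: rd => e1 [e2 e2'] e3 e4 e5 e6 _; split=> //; rewrite ?Fr2 //.
    by split; rewrite ?Fr2 ?Fa2.
  by rewrite cl.
by exists S; split=> //; split; rewrite ?Fr2 ?Fa2 //; case: rp.
Qed.

Lemma attempt_runs u C B m j h :
  ready u C B m h -> size C <= K -> u \in C -> 0 < B ->
  (closed -> m = size C) -> (~~ closed -> B = size C /\ m < k) ->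
  (forall i, i < m -> larr h aD i = digit B j i) ->
  runs w (attempt uni closed) h attempt_time (fun h' =>
    [/\ ready u C B m h', mono h h',
      forall i, i < m -> larr h' aD i = digit B j.+1 i &
      forall S, let P := picks closed u C m (digit B j) in
        uniq S -> S =i P -> k <= size S ->
        (forall x y, x \in S -> y \in S -> short_pair (dom S) x y) ->
        lreg h' rAns != 0]).
Proof.
move=> rd sC uC B0 cl ncl eD.
set P := picks closed u C m (digit B j).
have mb : m <= bound.
  rewrite /bound; case: (boolP closed) => c; first by rewrite (cl c).
  by have [_ /ltnW] := ncl c.
have dC : ~~ closed -> forall i, i < m -> digit B j i < size C.
  by move=> c i _; have [<- _] := ncl c; exact: ltn_pmod.
have subP : {subset P <= C} by apply: picks_sub.
have g := rd_glob rd.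
refine (runs_seq (T1 := select_time bound)
  (T2 := (if closed then rows_time else 0).+1 + (check_time bound + next_time bound)) _ _ _).
- apply: runs_frame; apply: (select_runs g (rd_C rd) (rd_m rd) (rd_u rd) eD).
    by move=> c; rewrite /bound c (cl c).
  by move=> c; rewrite /bound (negbTE c); have [] := ncl c; split=> //; exact: dC.
- move=> h1 [s1 Fr1 Fa1].
  have rd1 : ready u C B m h1.
    case: rd => e1 e2 e3 e4 e5 e6 M; split; rewrite ?Fr1 ?regs_written_select //.
    - exact: sel_glob s1.
    - apply: rep_frame e2; first by rewrite Fa1 // arrs_written_select.
      by rewrite Fr1 // regs_written_select.
    - move=> /M; rewrite /matrix !Fr1 ?regs_written_select // Fa1 ?arrs_written_select //.
  have mo1 : mono h h1 by rewrite /mono Fr1 // regs_written_select.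
  refine (runs_seq (T1 := (if closed then rows_time else 0).+1)
    (T2 := check_time bound + next_time bound)
    (runs_frame (middle_runs s1 rd1 subP sC)) _ _); last by [].
  move=> h2 [[rd2 mo2 [S [rpS uS sS SP MS]]] Fr2 Fa2].
  have g2 := rd_glob rd2.
  refine (runs_seq (T1 := check_time bound) (T2 := next_time bound)
    (runs_frame (check_runs uni g2 rpS sS)) _ _); last by [].
  move=> h3 [e3 Fr3 Fa3].
  have g3 : glob h3.
    apply: (glob_ans _ _ _ g2) => [r|a|].
    - by rewrite !inE => /or4P[|||/or4P[|||/orP[]]] /eqP -> // _; rewrite Fr3.
    - by rewrite !inE => /or4P[] /eqP ->; rewrite Fa3.
    - rewrite e3; case: ifP => [/andP[al kS] _|_]; last exact: g_ans g2.
      apply: (foundQ uS kS) => x y xS yS; apply: (linked_reach MS xS yS).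
      by move/allrelP: al; exact.
  have mo3 : mono h2 h3 by rewrite /mono e3; case: ifP.
  have rd3 : ready u C B m h3.
    case: rd2 => e1' e2' e3' e4' e5' e6' M; split; rewrite ?Fr3 //.
    - by apply: rep_frame e2'; rewrite ?Fa3 ?Fr3.
    - move=> /M [snd cmp]; split; rewrite Fa3 ?(Fr3 rMst) //.
      by move=> v x l t vS lR a; case: (cmp v x l t vS lR a) => [->|/mo3]; [left|right].
  have eD3 i : i < m -> larr h3 aD i = digit B j i.
    move=> li; rewrite Fa3 // Fa2; last by case: closed.
    by rewrite Fa1 ?arrs_written_select // eD.
  apply: runs_weak (runs_frame (next_runs B0 (rd_B rd3) (rd_m rd3) eD3)) _ _.
    by rewrite /next_time leq_add2r leq_mul2r mb.
  move=> h4 [D4 Fr4 Fa4].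
  have mo4 : mono h3 h4 by rewrite /mono Fr4.
  split=> //.
  + case: rd3 => e1' e2' e3' e4' e5' e6' M; split; rewrite ?Fr4 //.
    * apply: glob_frame e1' => [r|a].
        by rewrite !inE => /or4P[|||/or4P[|||/orP[]]] /eqP ->; rewrite Fr4.
      by rewrite !inE => /or4P[] /eqP ->; rewrite Fa4.
    * by apply: rep_frame e2'; rewrite ?Fa4 ?Fr4.
    * by move=> /M; rewrite /matrix !Fr4 // Fa4.
  + by move=> /mo1 /mo2 /mo3 /mo4.
  + move=> S' /=; rewrite -/P => uS' S'P kS' SS'; suff: lreg h3 rAns != 0 by move/mo4.
    rewrite e3; have SS x : (x \in S) = (x \in S') by rewrite S'P SP.
    have -> : k <= size S by rewrite (perm_size (uniq_perm uS uS' SS)).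
    rewrite andbT; case: allrelP => // nal.
    apply/negP => /eqP ans; case: nal => x y xS yS.
    have := SS' x y; rewrite -!SS xS yS -(eq_dom SS) => /(_ isT isT) sp.
    by have [|] := short_linked MS xS yS sp; rewrite ?ans.
- by rewrite /attempt_time; lia.
Qed.

Definition ready_regs := [:: rCl; rU; rB; rM; rMsk; rMst] ++ glob_regs.
Definition ready_arrs := aC :: glob_arrs.

Lemma ready_frame u C B m h h' :
  (forall r, r \in ready_regs -> lreg h' r = lreg h r) ->
  (forall a, a \in ready_arrs -> larr h' a = larr h a) ->
  ready u C B m h -> ready u C B m h'.
Proof.
move=> Fr Fa [e1 e2 e3 e4 e5 e6 M]; split; rewrite ?Fr //.
- apply: glob_frame e1 => [r rG|a aG]; first by rewrite Fr // /ready_regs mem_cat rG orbT.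
  by rewrite Fa // /ready_arrs inE aG orbT.
- by apply: rep_frame e2; rewrite ?Fa ?Fr.
- by move=> /M; rewrite /matrix !Fr // Fa.
Qed.

Lemma eq_picks u C m d d' : (forall i, i < m -> d i = d' i) ->
  picks closed u C m d = picks closed u C m d'.
Proof.
move=> E; have Ei i : i \in iota 0 m -> d i = d' i by rewrite mem_iota => /E.
rewrite /picks; case: closed.
  by congr map; apply: eq_in_filter => i /Ei ->.
by congr cons; apply/eq_in_map => i /Ei ->.
Qed.

Definition base C := if closed then 2 else size C.
Definition digits C := if closed then size C else k.-1.

Lemma picks_surj u C S : 0 < k -> u \in C -> uniq S -> {subset S <= C} ->
  (~~ closed -> size S = k /\ u \in S) ->
  exists2 j, j < base C ^ digits C & picks closed u C (digits C) (digit (base C) j) =i S.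
Proof.
move=> k0 uC uS SC open.
suff [d dB E] : exists2 d, forall i, i < digits C -> d i < base C &
    picks closed u C (digits C) d =i S.
  have [j lj ed] := digit_surj dB; exists j => //.
  by rewrite (eq_picks _ _ ed).
rewrite /base /digits /picks; case: closed open => [_|/(_ isT)[sS uinS]].
  exists (fun i => nth u C i \in S); first by move=> i _; case: (_ \in S).
  move=> x; apply/mapP/idP => [[i]|xS].
    by rewrite mem_filter eqb0 negbK => /andP[iS _] ->.
  exists (index x C); last by rewrite nth_index // SC.
  by rewrite mem_filter nth_index ?SC // xS mem_iota /= add0n index_mem SC.
have sr : size (rem u S) = k.-1 by rewrite size_rem // sS.
exists (fun i => index (nth u (rem u S) i) C).
  move=> i li; rewrite index_mem; apply: SC; apply: (@mem_rem _ u).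
  by apply: mem_nth; rewrite sr.
move=> x; rewrite (perm_mem (perm_to_rem uinS)); congr (x \in u :: _).
rewrite -[RHS](mkseq_nth u) sr /mkseq; apply/eq_in_map => i.
rewrite mem_iota add0n => /andP[_ li]; rewrite nth_index //.
by apply: SC; apply: (@mem_rem _ u); apply: mem_nth; rewrite sr.
Qed.

Definition branches := if closed then 2 ^ K else K ^ k.-1.
Definition search_time := (if closed then 0 else rows_time) + bound * (K * 2 + 6) + 6 +
  branches * attempt_time.+1.

Lemma search_runs u C h :
  glob h -> rep h aC rCl C -> rep h aS rSl C -> lreg h rU = u ->
  lreg h rMsk = 0 -> lreg h rLvl = 0 -> size C <= K -> u \in C -> 1 < k <= size C ->
  runs w (search uni closed) h search_time (fun h' =>
    [/\ glob h', mono h h' & forall S, uniq S -> {subset S <= C} -> k <= size S ->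
      (~~ closed -> size S = k /\ u \in S) ->
      (forall x y, x \in S -> y \in S -> short_pair (dom S) x y) -> lreg h' rAns != 0]).
Proof.
move=> g rC rS eu emsk elvl sC uC /andP[k1 kC].
have K2 : 1 < K by lia.
have B0 : 0 < base C by rewrite /base; case: (closed); lia.
have BK : base C <= K by rewrite /base; case: (closed); lia.
have mb : digits C <= bound by rewrite /digits /bound; case: (closed); lia.
have lb : base C ^ digits C <= branches.
  rewrite /base /digits /branches; case: (closed); first by rewrite leq_exp2l.
  by rewrite leq_exp2r //; lia.
refine (runs_seq (T1 := (if closed then 0 else rows_time) + 2)
  (T2 := bound * (K * 2 + 6) + 4 + branches * attempt_time.+1)
  (Q1 := fun h' => ready u C (base C) (digits C) h' /\ mono h h') _ _ _); last first.
- by rewrite /search_time; lia.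
- move=> h1 [rd1 mo1].
  refine (runs_seq (T1 := bound * (K * 2 + 4) + 2)
    (T2 := bound * 2 + 2 + branches * attempt_time.+1)
    (runs_frame (runs_weak (pow_runs _ (rd_B rd1) (rd_m rd1)) _ (fun _ => id))) _ _).
  + by rewrite leq_add2r; apply: leq_mul => //; lia.
  + move=> h2 [P2 Fr2 Fa2].
    have rd2 : ready u C (base C) (digits C) h2.
      apply: ready_frame rd1 => [r rG|a _]; last by rewrite Fa2.
      by rewrite Fr2 //; exact: (allP (isT : all [pred r | r \notin regs_written pow] ready_regs) _ rG).
    have mo2 : mono h1 h2 by rewrite /mono Fr2.
    refine (runs_seq (T1 := (digits C * 2).+1)
      (T2 := (branches * attempt_time.+1).+1)
      (Q1 := fun h' => [/\ ready u C (base C) (digits C) h', mono h2 h',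
         lreg h' rPw = base C ^ digits C &
         forall i, i < digits C -> larr h' aD i = 0]) _ _ _).
    * apply: runs_weak.
      - apply: runs_frame; apply: (runs_for (T := 1) (N := digits C)
          (I := fun i h' => forall j, j < i -> larr h' aD j = 0)) => //.
          exact: rd_m rd2.
        move=> i h3 li _ _ I3; split=> //= j; rewrite ltnS leq_eqVlt.
        by case: eqP => [->|_ /= /I3].
      - by [].
      move=> h3 [I3 Fr3 Fa3]; split; rewrite ?/mono ?Fr3 //.
      apply: ready_frame rd2 => [r rG|a aG].
        by rewrite Fr3 //; exact: (allP (isT : all [pred r | r \notin [:: rI3]] ready_regs) _ rG).
      by rewrite Fa3 //; exact: (allP (isT : all [pred a | a \notin [:: aD]] ready_arrs) _ aG).
    * move=> h3 [rd3 mo3 e3 D3].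
      apply: runs_weak.
      - apply: (runs_for (T := attempt_time) (N := base C ^ digits C) (I := fun j h' =>
          [/\ ready u C (base C) (digits C) h', mono h h',
            forall i, i < digits C -> larr h' aD i = digit (base C) j i &
            forall j' S, j' < j ->
              let P := picks closed u C (digits C) (digit (base C) j') in
              uniq S -> S =i P -> k <= size S ->
              (forall x y, x \in S -> y \in S -> short_pair (dom S) x y) ->
              lreg h' rAns != 0])) => //.
        + split=> //; first by move=> /mo1 /mo2 /mo3.
          by move=> i li; rewrite D3 // /digit div0n mod0n.
        move=> j h4 lj _ _ [rd4 mo4 D4 S4].
        set h5 := setr h4 rX2 j.
        have rd5 : ready u C (base C) (digits C) h5.
          apply: ready_frame rd4 => // r rG /=; rewrite ifF //.
          by apply/negbTE; exact: (allP (isT : all [pred r | r != rX2] ready_regs) _ rG).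
        apply: runs_weak (leqnn _) _.
          apply: (attempt_runs rd5 sC uC B0 _ _ D4).
            by rewrite /digits => ->.
          by rewrite /digits /base => /negbTE ->; split=> //; lia.
        move=> h6 [rd6 mo6 D6 S6]; split=> //.
          by move=> /mo4 a; apply: mo6.
        move=> j' S; rewrite ltnS leq_eqVlt => /orP[/eqP -> |lj']; first exact: S6.
        by move=> /= uS SP kS SS; apply: mo6; apply: (S4 j' S).
      - by rewrite ltnS leq_mul2r lb orbT.
      move=> h4 [rd4 mo4 _ S4]; split=> //; first exact: rd_glob rd4.
      move=> S uS SC kS op SS; have [j lj E] := picks_surj (ltnW k1) uC uS SC op.
      by apply: (S4 j S) => // x; rewrite E.
    * by lia.
  + lia.
rewrite /base /digits; case: ifP => cl.
  split=> //=; split=> //; split=> //=.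
  - by do 2 (apply: glob_setr; first by []).
  - by case: rC.
  - by rewrite cl.
have lvl x : (lreg h rLvl - larr h aA x == 0) = (x \in [set: 'I_n]).
  by rewrite elvl inE.
refine (runs_seq (T1 := rows_time) (T2 := 2)
  (runs_frame (rows_runs g rS sC emsk lvl)) _ _); last by [].
move=> h1 [[g1 M1 mo1] Fr1 Fa1]; split=> //=; split=> //; split=> //=.
- by do 2 (apply: glob_setr; first by []).
- by apply: rep_frame rC; rewrite ?Fa1 //= Fr1.
- by rewrite Fr1.
- by rewrite Fr1 //; case: rC.
- by rewrite Fr1 // (g_k g) subn1.
- by rewrite Fr1.
Qed.

Definition vertex_time := cand_time + (if k <= K then search_time else 0) + 2.

Definition near u x := exists l t, l <= R /\ arrives G m0 setT u l x t.

Lemma vertex_runs u h : 1 < k -> glob h -> lreg h rU = u ->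
  runs w (vertex uni closed) h vertex_time (fun h' =>
    [/\ glob h', mono h h',
      (exists Y, K < #|Y| /\ forall x, x \in Y -> near u x) -> lreg h' rAns != 0 &
      forall S, uniq S -> (forall x, x \in S -> near u x) -> k <= size S ->
        (~~ closed -> size S = k /\ u \in S) ->
        (forall x y, x \in S -> y \in S -> short_pair (dom S) x y) -> lreg h' rAns != 0]).
Proof.
move=> k1 g eu.
refine (runs_seq (T1 := cand_time) (T2 := (if k <= K then search_time else 0).+2)
  (runs_frame (cand_runs g eu)) _ _); last by rewrite /vertex_time; lia.
move=> h1 [[C [g1 rC rS [sC uC uC1] [cmp emsk elvl mo1]]] Fr1 Fa1].
have ov1 : (exists Y, K < #|Y| /\ forall x, x \in Y -> near u x) -> lreg h1 rAns != 0.
  case=> Y [lY nY]; apply/negP => /eqP ans.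
  have : Y \subset [set x in C].
    apply/subsetP => x /nY [l [t [lR a]]]; rewrite inE.
    by case: (cmp _ _ _ lR a) => //; rewrite ans.
  move/subset_leq_card; rewrite cardsE (card_uniqP uC) => le.
  by move: (leq_trans lY (leq_trans le sC)); rewrite ltnn.
have eC : lreg h1 rCl = size C by case: rC.
have near1 x : near u x -> lreg h1 rAns = 0 -> x \in C.
  by case=> l [t [lR a]] ans; case: (cmp _ _ _ lR a) => //; rewrite ans.
apply: runs_if => /=; rewrite eC (g_k g1) => H; last first.
  split=> //; split=> // S uS nS kS _ _; apply/negP => /eqP ans.
  have : size S <= size C by apply: uniq_leq_size => // x /nS /near1 ->.
  by move: H kS; lia.
have kC : k <= size C by lia.
have eu1 : lreg h1 rU = u by rewrite Fr1.
have k1C : 1 < k <= size C by rewrite k1.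
apply: runs_weak (search_runs g1 rC rS eu1 emsk elvl sC uC1 k1C) _ _.
  by rewrite (leq_trans kC sC).
move=> h2 [g2 mo2 S2]; split=> //.
- by move=> /mo1 /mo2.
- by move=> /ov1 /mo2.
move=> S uS nS kS op SS; have [ans|/mo2 //] := eqVneq (lreg h1 rAns) 0.
by apply: (S2 S) => // x /nS /near1 ->.
Qed.

End Machine.

Section Main.

Variables (n tau : nat) (G : tgraph n tau) (k : nat) (uni closed : bool) (Q : Prop).
Local Notation w := (encode G k).
Implicit Types (X Y : {set 'I_n}) (u v x y : 'I_n) (S P : seq 'I_n) (h : lstate).

Definition expo := if uni then k.-1 else tau.
Definition capacity := k.-1 ^ expo.
Definition rounds := if uni then k.-1 else capacity.
Definition mask := if uni then tau else 0.

Local Notation K := capacity.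
Local Notation R := rounds.

Hypothesis trivialQ : k <= 1 -> (Q <-> 0 < n).
Hypothesis overflowQ : 1 < k -> forall u, overflow G K R mask u -> Q.
Hypothesis foundQ : forall P, uniq P -> k <= size P ->
  (forall x y, x \in P -> y \in P -> reach_pair G uni (dom closed P) x y) -> Q.
Hypothesis completeQ : 1 < k -> Q ->
  (forall u Y, (forall x, x \in Y -> near G R mask u x) -> #|Y| <= K) ->
  exists u S, [/\ uniq S, forall x, x \in S -> near G R mask u x, k <= size S,
    ~~ closed -> size S = k /\ u \in S &
    forall x y, x \in S -> y \in S -> short_pair G R uni (dom closed S) x y].

Lemma degree_overflow v : 1 < k -> K <= size (neighbours G v) -> overflow G K R mask v.
Proof.
move=> k1 le; exists [set x in v :: neighbours G v]; split.
  rewrite cardsE; have /card_uniqP -> : uniq (v :: neighbours G v).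
    rewrite /= filter_uniq ?enum_uniq // andbT mem_filter.
    apply/negP => /andP[/andP[/edges_card2 + _] _].
    by rewrite setUid cards1.
  by rewrite /= ltnS.
have R0 : 0 < R.
  by rewrite /rounds /capacity; case: (uni); rewrite ?expn_gt0; lia.
move=> x; rewrite inE in_cons => /orP[/eqP ->|xv].
  by split; [exists 0, 0; exact: Arrives0|exact: within_steps0].
split; last exact: within_steps_mono (R0) (within_stepsS (within_steps0 G 0 v) xv).
move: xv; rewrite mem_filter => /andP[/andP[e /set0Pn[s sl]] _].
by exists 1, s; apply: ArrivesS (Arrives0 _ _ _ _) e sl _ (in_setT _).
Qed.

Definition main_time := expo * (k.-1 * 2 + 4) + n * (vertex_time k K R closed + 7) + 20.

Lemma main_runs : runs w (main uni closed) linit main_time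
  (fun h => lreg h rAns != 0 <-> Q).
Proof.
have -> : main_time = (main_time - 3).+3 by rewrite /main_time; lia.
have inp h (i v : nat) : cell w i v -> leval w h (LInp (LCst i)) = v by move=> c; apply: leval_inp.
do 3 apply: runs_set.
rewrite !(inp _ _ _ (cell_n G k), inp _ _ _ (cell_tau G k), inp _ _ _ (cell_k G k)).
set h0 := setr _ rK _.
have -> : main_time - 3 = (main_time - 4).+1 by rewrite /main_time; lia.
apply: runs_if => /=; last first.
  move=> k1; split; first by rewrite [cost _ _ _]/= /main_time; lia.
  rewrite /= trivialQ; last by lia.
  by rewrite lt0n.
move=> k1; have {}k1 : 1 < k by lia.
have K0 : 0 < K by rewrite /capacity expn_gt0; lia.
have -> : main_time - 4 = (main_time - 6).+2 by rewrite /main_time; lia.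
do 2 apply: runs_set; rewrite [leval _ _ _]/= subn1.
set h1 := setr _ rM _.
have eB : lreg h1 rB = k.-1 by rewrite /= ?subn1.
have eM : lreg h1 rM = expo by rewrite /= /expo; case: (uni); rewrite /= ?subn1.
refine (runs_seq (T1 := expo * (k.-1 * 2 + 4) + 2)
  (T2 := n * (vertex_time k K R closed + 7) + 10)
  (runs_frame (pow_runs w eB eM)) _ _); last by rewrite /main_time; lia.
move=> h2 [P2 Fr2 Fa2].
rewrite addnC; do 3 apply: runs_set.
set h3 := setr _ rMsk0 _.
have c3 : [/\ lreg h3 rN = n, lreg h3 rTau = tau, lreg h3 rK = k, lreg h3 rCap = K &
    [/\ lreg h3 rR = R, lreg h3 rMsk0 = mask, lreg h3 rAns = 0, lreg h3 rCk = 0 &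
    forall a i, larr h3 a i = 0]].
  split; rewrite /= ?(Fr2 rN, Fr2 rTau, Fr2 rK) //; split; rewrite ?(Fr2 rAns, Fr2 rCk) //.
  - by rewrite /rounds; case: (uni) => //=; rewrite Fr2 //= subn1.
  - by rewrite /mask; case: (uni) => /=; rewrite ?Fr2.
  - by move=> a i; rewrite Fa2.
clearbody h3; case: c3 => en et ek eK [eR em eans eck earr].
apply: (runs_seq (T1 := n * 3 + 2) (T2 := n * (vertex_time k K R closed + 4) + 5)
  (Q1 := fun h' => [/\ glob n tau k K R mask Q h' & lreg h' rAns = 0])); last by lia.
  rewrite addnS; apply: runs_set; rewrite [leval _ _ _]/= addn1.
  apply: runs_weak (leqnn _) _.
    apply: runs_frame; apply: (runs_for (T := 2) (N := n) (I := fun i h' =>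
      lreg h' rQ = i * n /\ forall j, j < i -> larr h' aRow j = j * n)) => //.
    move=> i h4 li Fr4 Fa4 [Iq Ir]; split=> //=; split; first by rewrite Iq (Fr4 rN) //= en; lia.
    move=> j; rewrite ltnS leq_eqVlt Iq.
    by case: eqP => [->|_ /= /Ir].
  move=> h4 [[_ row4] Fr4 Fa4]; split; last by rewrite Fr4.
  split; rewrite ?Fr4 //= ?eans ?eck //.
  - by move=> v; rewrite row4.
  - by move=> x; rewrite Fa4 //= earr.
  - by move=> x; rewrite Fa4 //= earr.
  - by move=> i; rewrite Fa4 //= earr.
move=> h4 [g4 a4].
apply: (runs_seq (T1 := (n * 3).+1) (T2 := n * (vertex_time k K R closed + 1) + 3)
  (Q1 := fun h' => glob n tau k K R mask Q h' /\
    (lreg h' rAns = 0 -> forall v, size (neighbours G v) <= K))); last by lia.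
  apply: runs_weak (leqnn _) _.
    apply: runs_frame; apply: (runs_for (T := 2) (N := n) (I := fun i h' =>
      (lreg h' rAns != 0 -> Q) /\
      forall v, v < i -> lreg h' rAns = 0 -> size (neighbours G v) <= K)).
    - exact: g_n g4.
    - by rewrite a4.
    move=> i h5 li Fr5 Fa5 [aQ5 D5].
    set v := Ordinal li.
    have ed : leval w (setr h5 rI3 i) (LInp (LInp (LAdd (LCst 3) rI3)))
        = size (neighbours G v).
      apply: leval_inp; rewrite (leval_inp (v := nth 0 w (3 + v))); first exact: cell_deg.
      by split=> //; have [] := cell_block_address G k (ltnW (ltn_ord v)).
    apply: runs_if => [H|H].
      split=> //=; split=> // _; apply: (overflowQ k1 (u := v)).
      apply: degree_overflow => //; move: H.
      rewrite [leval _ _ _]/= -/(leval w (setr h5 rI3 i) (LInp (LInp (LAdd (LCst 3) rI3)))).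
      by rewrite ed Fr5 // (g_cap g4); lia.
    split=> //=; split=> // x; rewrite ltnS leq_eqVlt => /orP[/eqP xi _|/D5 //].
    have -> : x = v by apply: val_inj.
    move: H; rewrite [leval _ _ _]/= -/(leval w (setr h5 rI3 i) (LInp (LInp (LAdd (LCst 3) rI3)))).
    by rewrite ed Fr5 // (g_cap g4); lia.
  move=> h5 [[aQ5 D5] Fr5 Fa5]; split.
    apply: glob_ans g4 => // [r|a _]; last by rewrite Fa5.
    by rewrite !inE => /or4P[|||/or4P[|||/orP[]]] /eqP -> // _; rewrite Fr5.
  by move=> a5 v; apply: D5.
move=> h5 [g5 deg5].
rewrite addnS; apply: runs_if => /= a5.
  split; first by rewrite addnS.
  by split=> // _; exact: (g_ans g5 a5).
have fQ P : uniq P -> k <= size P ->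
  (forall x y, x \in P -> y \in P -> reach_pair G uni (dom closed P) x y) -> Q.
  exact: foundQ.
apply: runs_weak.
- apply: (runs_for (T := vertex_time k K R closed) (N := n) (I := fun i h' =>
    [/\ glob n tau k K R mask Q h',
      forall u, u < i -> (exists Y, K < #|Y| /\ forall x, x \in Y -> near G R mask u x) ->
        lreg h' rAns != 0 &
      forall u S, u < i -> uniq S -> (forall x, x \in S -> near G R mask u x) ->
        k <= size S -> (~~ closed -> size S = k /\ u \in S) ->
        (forall x y, x \in S -> y \in S -> short_pair G R uni (dom closed S) x y) ->
        lreg h' rAns != 0])).
  + exact: g_n g5.
  + by [].
  move=> i h6 li _ _ [g6 ov6 S6].
  set u := Ordinal li.
  have g7 : glob n tau k K R mask Q (setr h6 rU i) by apply: glob_setr.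
  apply: runs_weak (vertex_runs (u := u) (overflowQ k1) (deg5 a5) K0 fQ k1 g7 _) _ _ => //.
  move=> h8 [g8 mo8 ov8 S8]; split=> // x; rewrite ltnS leq_eqVlt.
    case/orP=> [/eqP xi|lx] H; first by apply: ov8; rewrite (_ : u = x) //; exact: val_inj.
    by apply: mo8; exact: (ov6 x).
  move=> S /orP[/eqP xi|lx] *.
    by apply: (S8 S) => //; rewrite (_ : u = x) //; exact: val_inj.
  by apply: mo8; exact: (S6 x S).
- by rewrite addn1; lia.
move=> h6 [g6 ov6 S6]; split; first exact: g_ans g6.
move=> q; apply/negP => /eqP a6.
have [|u [S [uS nS kS op SS]]] := completeQ k1 q.
  move=> u Y nY; rewrite leqNgt; apply/negP => lY.
  have : lreg h6 rAns != 0 by apply: (ov6 u) => //; exists Y.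
  by rewrite a6.
have : lreg h6 rAns != 0 by apply: (S6 u S).
by rewrite a6.
Qed.

End Main.

(** * Temporal paths *)

Section Paths.

Variables (n tau : nat) (G : tgraph n tau).
Implicit Types (X Y D : {set 'I_n}) (u v x y z : 'I_n) (p q S : seq 'I_n).
Implicit Types (ts : seq 'I_tau).

Definition end_time ts := last 0 [seq val t | t <- ts].

Lemma sorted_path0 s : sorted leq s = path leq 0 s.
Proof. by case: s. Qed.

Lemma path_edges_rcons u p x :
  path_edges u (rcons p x) = rcons (path_edges u p) [set last u p; x].
Proof. by elim: p u => //= y p IH u; rewrite IH. Qed.

Lemma all2_rcons (A B : Type) (r : A -> B -> bool) (s : seq A) a (t : seq B) b :
  all2 r (rcons s a) (rcons t b) = all2 r s t && r a b.
Proof.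
elim: s t => [|a' s IH] [|b' t] //=; first by rewrite andbT.
- by case: t => [|? ?] /=; rewrite andbF.
- by case: s {IH} => [|? ?] /=; rewrite andbF.
- by rewrite IH andbA.
Qed.

Lemma temporal_path_size u p ts : temporal_path G u p ts -> size ts = size p.
Proof.
case/and4P=> _ _ _; rewrite all2E => /andP[/eqP <- _].
by rewrite /path_edges size_pairmap.
Qed.

Lemma temporal_path_rcons u p x ts (s : 'I_tau) :
  temporal_path G u (rcons p x) (rcons ts s) =
  [&& temporal_path G u p ts, x \notin u :: p, [set last u p; x] \in edges G,
      s \in lab G [set last u p; x] & end_time ts <= s].
Proof.
rewrite /temporal_path path_edges_rcons -rcons_cons rcons_uniq all_rcons all2_rcons.
rewrite map_rcons !sorted_path0 rcons_path /end_time.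
apply/and4P/and5P => [[/andP[a b] /andP[c d] /andP[e f] /andP[g h]]|[/and4P[b d e g] a c h f]].
  by split=> //; apply/and4P.
by split=> //; apply/andP.
Qed.

Lemma temporal_path_take u p q ts : temporal_path G u (p ++ q) ts ->
  exists2 ts', temporal_path G u p ts' & end_time ts' <= end_time ts.
Proof.
elim/last_ind: q ts => [|q x IH] ts; first by rewrite cats0; exists ts.
rewrite -rcons_cat; case/lastP: ts => [|ts s].
  by move/temporal_path_size; rewrite size_rcons.
rewrite temporal_path_rcons => /and5P[/IH[ts' tp' le] _ _ _ le'].
exists ts' => //; rewrite {2}/end_time map_rcons last_rcons.
exact: leq_trans le'.
Qed.

Lemma temporal_path_behead u x p ts : temporal_path G u (x :: p) ts ->
  temporal_path G x p (behead ts).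
Proof.
case: ts => [|t ts] /and4P[] /= /andP[_ uq] /andP[_ al] so; first by [].
case/andP=> _ a2; apply/and4P; split=> //.
by move: so => /=; apply: path_sorted.
Qed.

Lemma temporal_path_drop u p q ts : temporal_path G u (p ++ q) ts ->
  exists ts', temporal_path G (last u p) q ts'.
Proof.
elim: p u ts => [|x p IH] u ts; first by exists ts.
by move/temporal_path_behead/IH.
Qed.

Lemma arrives_path X u l x t : arrives G 0 X u l x t -> u \in X ->
  exists p ts, [/\ temporal_path G u p ts, last u p = x, size p <= l,
    {subset u :: p <= X} & end_time ts <= t].
Proof.
move=> a uX; elim: a => [|l' v t' {}x s _ [p [ts [tp lp sp pX le]]] e sl ts' xX].
  by exists [::], [::]; split=> // z; rewrite inE => /eqP ->.
case: (boolP (x \in u :: p)) => [xp|xp].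
  case/splitPl: xp tp lp sp pX => p1 p2 lp1 tp lp sp pX.
  have [ts1 tp1 le1] := temporal_path_take tp.
  exists p1, ts1; split=> //.
  - by move: sp; rewrite size_cat; lia.
  - by move=> z zp; apply: pX; rewrite -cat_cons mem_cat zp.
  - by move: ts'; lia.
exists (rcons p x), (rcons ts s); split.
- by rewrite temporal_path_rcons tp xp lp e sl; move: ts'; lia.
- by rewrite last_rcons.
- by rewrite size_rcons.
- by move=> z; rewrite -rcons_cons mem_rcons inE => /orP[/eqP -> //|/pX].
- by rewrite /end_time map_rcons last_rcons.
Qed.

Lemma path_arrives X u p ts : temporal_path G u p ts -> {subset u :: p <= X} ->
  arrives G 0 X u (size p) (last u p) (end_time ts).
Proof.
elim/last_ind: p ts => [|p x IH] ts.
  move=> tp _; have := temporal_path_size tp; case: ts {tp} => //= _.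
  exact: Arrives0.
case/lastP: ts => [|ts s] tp; first by move/temporal_path_size: tp; rewrite size_rcons.
move=> pX; move: tp; rewrite temporal_path_rcons => /and5P[tp _ e sl le].
rewrite size_rcons last_rcons /end_time map_rcons last_rcons.
apply: ArrivesS e sl _ _; last by apply: pX; rewrite -rcons_cons mem_rcons mem_head.
  by apply: IH tp _ => z zp; apply: pX; rewrite -rcons_cons mem_rcons inE zp orbT.
by move: le; rewrite subn0.
Qed.

Lemma prefix_arrives X u p q ts : temporal_path G u (p ++ q) ts ->
  {subset u :: p <= X} -> exists t, arrives G 0 X u (size p) (last u p) t.
Proof.
move=> /temporal_path_take [ts' tp' _] pX.
by exists (end_time ts'); exact: path_arrives.
Qed.

Lemma reaches_withinE X u x : u \in X ->
  reaches_within G X u x <-> exists l t, arrives G 0 X u l x t.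
Proof.
move=> uX; split=> [[p [ts [tp <- pX]]]|[l [t a]]].
  by exists (size p), (end_time ts); exact: path_arrives.
by have [p [ts [tp lp _ pX _]]] := arrives_path a uX; exists p, ts.
Qed.

Lemma reachesE u x : reaches G u x <-> exists l t, arrives G 0 setT u l x t.
Proof.
rewrite -reaches_withinE ?inE //; split=> [[p [ts [tp lp]]]|[p [ts [tp lp _]]]].
  by exists p, ts; split=> // z _; rewrite inE.
by exists p, ts.
Qed.

Lemma mem_split u p x : x \in u :: p -> exists p1 p2, p = p1 ++ p2 /\ last u p1 = x.
Proof. by case/splitPl=> p1 p2 lp; exists p1, p2. Qed.

Definition path_pair D l x y := exists l' t, l' <= l /\ arrives G 0 D x l' y t.

(* A temporal path orders its vertices so that each one reaches the later ones. *)
Lemma path_linked u p ts x y : temporal_path G u p ts -> x \in u :: p -> y \in u :: p ->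
  path_pair [set z in u :: p] (size p) x y \/ path_pair [set z in u :: p] (size p) y x.
Proof.
have sub p1 q1 q2 : p = p1 ++ q1 ++ q2 ->
    temporal_path G u p ts -> path_pair [set z in u :: p] (size p) (last u p1) (last u (p1 ++ q1)).
  move=> -> /temporal_path_drop [ts' tp].
  have [|t a] := prefix_arrives (X := [set z in u :: p1 ++ q1 ++ q2]) tp.
    move=> z zq; rewrite in_set -cat_cons mem_cat.
    move: zq; rewrite in_cons => /orP[/eqP ->|zq]; first by rewrite mem_last.
    by rewrite mem_cat zq orbT.
  by exists (size q1), t; rewrite last_cat !size_cat; split=> //; lia.
move=> tp /mem_split [p1 [p2 [ep lp1]]] yp.
have [yp1|yp2] : y \in u :: p1 \/ y \in last u p1 :: p2.
- move: yp; rewrite {1}ep -cat_cons mem_cat => /orP[|yp]; [by left|right].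
  by rewrite inE yp orbT.
- right; have [q1 [q2 [eq lq1]]] := mem_split yp1.
  by rewrite -lq1 -lp1 eq; apply: (sub _ _ p2) => //; rewrite catA -eq.
left; have [q1 [q2 [eq lq1]]] := mem_split yp2.
by rewrite -lq1 -last_cat -lp1; apply: (sub _ _ q2) => //; rewrite -eq.
Qed.

End Paths.

(** * Connected sets *)

Lemma card_bigcup_le (I T : finType) (A : {set I}) (F : I -> {set T}) c :
  (forall i, i \in A -> #|F i| <= c) -> #|\bigcup_(i in A) F i| <= #|A| * c.
Proof.
move=> Fc; rewrite -sum_nat_const; elim/big_ind2: _ => [|m X m' Y lX lY|//].
  by rewrite cards0.
exact: leq_trans (leq_card_setU _ _) (leq_add lX lY).
Qed.

Section Connected.

Variables (n tau : nat) (G : tgraph n tau) (k : nat).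
Implicit Types (X Y D : {set 'I_n}) (u v x y z : 'I_n) (p q S P : seq 'I_n).

Lemma card_le X : #|X| <= n.
Proof. by rewrite -[n in _ <= n]card_ord max_card. Qed.

Definition conn uni (closed : bool) X :=
  forall x y, x \in X -> y \in X ->
    reach_pair G uni (if closed then X else setT) x y.

Definition conn_ge uni closed := exists X, conn uni closed X /\ k <= #|X|.

Lemma inclusion_maximal_ge (P : {set 'I_n} -> Prop) :
  (exists X, inclusion_maximal P X /\ k <= #|X|) <-> exists X, P X /\ k <= #|X|.
Proof.
split=> [[X [[PX _] kX]]|[X [PX kX]]]; first by exists X.
have [m] := ubnP (n - #|X|); elim: m X PX kX => // m IH X PX kX lm.
case: (classic (exists Y, [/\ X \subset Y, P Y & Y <> X])) => [[Y [XY PY YX]]|nY].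
  have lt : #|X| < #|Y|.
    by rewrite proper_card // properEneq XY andbT; apply/eqP => E; apply: YX.
  apply: (IH Y) => //; first by apply: leq_trans kX (ltnW lt).
  by have := card_le Y; lia.
exists X; split=> //; split=> // Y XY PY; apply: NNPP => YX.
by apply: nY; exists Y.
Qed.

Lemma has_TCCE : has_TCC G k <-> conn_ge false false.
Proof.
rewrite /has_TCC /TCC inclusion_maximal_ge /conn_ge.
split=> -[X [cX kX]]; exists X; split=> // x y xX yX.
  by have [/reachesE] := cX x y xX yX.
by split; apply/reachesE; exact: cX.
Qed.

Lemma has_closed_TCCE : has_closed_TCC G k <-> conn_ge false true.
Proof.
rewrite /has_closed_TCC /closed_TCC inclusion_maximal_ge /conn_ge.
split=> -[X [cX kX]]; exists X; split=> // x y xX yX.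
  by have [/(reaches_withinE _ _ xX)] := cX x y xX yX.
by split; apply/reaches_withinE => //; exact: cX.
Qed.

Lemma has_TUCCE : has_TUCC G k <-> conn_ge true false.
Proof.
rewrite /has_TUCC /TUCC inclusion_maximal_ge /conn_ge.
split=> -[X [cX kX]]; exists X; split=> // x y xX yX.
  by have [/reachesE|/reachesE] := cX x y xX yX; [left|right].
by have [/reachesE|/reachesE] := cX x y xX yX; [left|right].
Qed.

Lemma has_closed_TUCCE : has_closed_TUCC G k <-> conn_ge true true.
Proof.
rewrite /has_closed_TUCC /closed_TUCC inclusion_maximal_ge /conn_ge.
split=> -[X [cX kX]]; exists X; split=> // x y xX yX.
  by have [/(reaches_withinE _ _ xX)|/(reaches_withinE _ _ yX)] := cX x y xX yX; [left|right].
by have [/(reaches_withinE _ _ xX)|/(reaches_withinE _ _ yX)] := cX x y xX yX; [left|right].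
Qed.

Lemma reach_pair_mono uni X X' x y : X \subset X' ->
  reach_pair G uni X x y -> reach_pair G uni X' x y.
Proof.
move=> sX; have H a b : (exists l t, arrives G 0 X a l b t) ->
    exists l t, arrives G 0 X' a l b t.
  by move=> [l [t c]]; exists l, t; exact: arrives_mono c.
by rewrite /reach_pair /linkable; case: uni => [[/H|/H]|/H]; [left|right|].
Qed.

Lemma conn_open uni closed X : conn uni true X -> conn uni closed X.
Proof.
move=> cX x y xX yX; apply: reach_pair_mono (cX x y xX yX).
by case: closed.
Qed.

Lemma conn_trivial uni closed : 0 < k -> k <= 1 -> conn_ge uni closed <-> 0 < n.
Proof.
move=> k0 k1; split=> [[X [_ kX]]|n0].
  by have := card_le X; lia.
exists [set Ordinal n0]; split; last by rewrite cards1.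
move=> x y; rewrite !inE => /eqP -> /eqP ->.
have H D : exists l t, arrives G 0 D (Ordinal n0) l (Ordinal n0) t.
  by exists 0, 0; exact: Arrives0.
by rewrite /reach_pair /linkable; case: uni; [left|].
Qed.

Lemma conn_found uni closed P : uniq P -> k <= size P ->
  (forall x y, x \in P -> y \in P -> reach_pair G uni (dom closed P) x y) ->
  conn_ge uni closed.
Proof.
move=> uP kP H; exists [set x in P]; split; last by rewrite cardsE (card_uniqP uP).
by move=> x y; rewrite !inE; exact: H.
Qed.

Section Snapshots.

Definition active (t : 'I_tau) : rel 'I_n :=
  fun x y => ([set x; y] \in edges G) && (t \in lab G [set x; y]).

Definition snapshot_comp t v := [set x | connect (active t) v x].

Lemma active_connect_sym t : connect_sym (active t).
Proof. by apply: sym_connect_sym => x y; rewrite /active setUC. Qed.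

Lemma snapshot_comp_conn t v : conn false true (snapshot_comp t v).
Proof.
set C := snapshot_comp t v => x y xC yC.
have : connect (active t) x y.
  rewrite !inE in xC yC; apply: connect_trans yC; by rewrite active_connect_sym.
case/connectP=> p pp ->; exists (size p).
suff [t' _ a] : exists2 t', t' <= t & arrives G 0 C x (size p) (last x p) t' by exists t'.
elim/last_ind: p pp => [|p z IH]; first by exists 0 => //; exact: Arrives0.
rewrite rcons_path => /andP[pp az]; have [t' lt a] := IH pp.
exists t => //; rewrite size_rcons last_rcons; case/andP: (az) => e tl.
apply: ArrivesS a e tl _ _; first by rewrite subn0.
rewrite inE; apply: connect_trans (connect1 az).
rewrite inE in xC; apply: connect_trans xC _.
by apply/connectP; exists p.
Qed.

(* Everything that [u] reaches lies in the set obtained from [u] by taking, at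
   each time in turn, the connected components of the current snapshot. *)
Fixpoint spread u (i : nat) : {set 'I_n} :=
  if i is j.+1 then
    if insub j is Some t then \bigcup_(v in spread u j) snapshot_comp t v
    else spread u j
  else [set u].

Lemma spreadS u (t : 'I_tau) :
  spread u t.+1 = \bigcup_(v in spread u t) snapshot_comp t v.
Proof. by rewrite /= valK. Qed.

Lemma spread_mono u i j : i <= j -> spread u i \subset spread u j.
Proof.
move/subnK <-; elim: (j - i) => // m IH; apply: subset_trans IH _.
rewrite addSn /=; case: insub => // t.
by apply/subsetP => x xS; apply/bigcupP; exists x => //; rewrite inE.
Qed.

Lemma arrives_spread u l x t : arrives G 0 setT u l x t ->
  forall s : 'I_tau, t <= s -> x \in spread u s.+1.
Proof.
elim=> [s _|l' v t' {}x s _ IH e sl ts _ s' ss'].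
  by apply: (subsetP (spread_mono u (leq0n s.+1))); rewrite inE.
apply: (subsetP (spread_mono u (ss' : s < s'.+1))).
have : v \in spread u s.+1 by apply: IH; move: ts; rewrite subn0.
rewrite !spreadS => /bigcupP[z zS zv]; apply/bigcupP; exists z => //.
move: zv; rewrite !inE => zv; apply: connect_trans zv (connect1 _).
by rewrite /active e.
Qed.

Lemma snapshot_overflow u Y : k.-1 ^ tau < #|Y| ->
  (forall x, x \in Y -> exists l t, arrives G 0 setT u l x t) ->
  conn_ge false true.
Proof.
move=> lY HY.
have [/existsP[t /existsP[v kC]]|no] :=
    boolP [exists t : 'I_tau, exists v, k <= #|snapshot_comp t v|].
  by exists (snapshot_comp t v); split=> //; exact: snapshot_comp_conn.
have small t v : #|snapshot_comp t v| <= k.-1.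
  move/existsPn: no => /(_ t) /existsPn /(_ v); rewrite -ltnNge.
  by case: k => // k'.
have card i : #|spread u i| <= k.-1 ^ i \/ tau < i.
  elim: i => [|i IH]; first by rewrite cards1; left.
  case: (ltnP i tau) => li; last by right.
  case: IH => [IH|]; last by lia.
  left; rewrite -[i]/(val (Ordinal li)) spreadS expnS mulnC.
  apply: leq_trans (card_bigcup_le (fun v _ => small _ v)) _.
  by rewrite leq_mul2r IH orbT.
have sub : Y \subset spread u tau.
  apply/subsetP => x /HY [l [t a]].
  case: a => [|l' v t' x' s a e sl ts xT].
    by apply: (subsetP (spread_mono u (leq0n tau))); rewrite inE.
  apply: (subsetP (spread_mono u (ltn_ord s))).
  by apply: (arrives_spread (ArrivesS a e sl ts xT)).
by have := subset_leq_card sub; case: (card tau); lia.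
Qed.

End Snapshots.

Section Stars.

Definition star v := [set x in v :: neighbours G v].

Lemma in_star v x : (x \in star v) = (x == v) || (x \in neighbours G v).
Proof. by rewrite in_set in_cons. Qed.

Lemma star_conn v : conn true true (star v).
Proof.
have leaf x : x \in neighbours G v -> exists s : 'I_tau,
    [/\ [set v; x] \in edges G, s \in lab G [set v; x] & x \in star v].
  move=> xN; move: (xN); rewrite mem_filter => /andP[/andP[e /set0Pn[s sl]] _].
  by exists s; rewrite e sl in_star xN orbT.
have vS : v \in star v by rewrite in_star eqxx.
move=> x y xS yS; rewrite /reach_pair /linkable.
move: (xS) (yS); rewrite !in_star.
case/orP=> [/eqP ->|/leaf[s [ex sx _]]]; case/orP=> [/eqP ->|/leaf[s' [ey sy _]]].
- by left; exists 0, 0; exact: Arrives0.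
- by left; exists 1, s'; apply: ArrivesS (Arrives0 _ _ _ _) ey sy _ yS.
- by right; exists 1, s; apply: ArrivesS (Arrives0 _ _ _ _) ex sx _ xS.
have two a b (s1 s2 : 'I_tau) : [set v; a] \in edges G -> s1 \in lab G [set v; a] ->
    [set v; b] \in edges G -> s2 \in lab G [set v; b] -> b \in star v -> s1 <= s2 ->
    exists l t, arrives G 0 (star v) a l b t.
  move=> ea sa eb sb bS le; exists 2, s2.
  apply: ArrivesS eb sb _ bS; last by rewrite subn0; exact: le.
  by apply: ArrivesS (Arrives0 _ _ _ _) _ _ _ vS; rewrite // setUC.
case: (leqP s s') => [le|/ltnW le]; [left|right].
  exact: (two x y s s').
exact: (two y x s' s).
Qed.

Fixpoint ball u r : {set 'I_n} :=
  if r is r'.+1 then \bigcup_(v in ball u r') star v else [set u].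

Lemma ball_mono u i j : i <= j -> ball u i \subset ball u j.
Proof.
move/subnK <-; elim: (j - i) => // m IH; apply: subset_trans IH _.
apply/subsetP => x xS; apply/bigcupP; exists x => //.
by rewrite in_star eqxx.
Qed.

Lemma within_steps_ball r u x : within_steps G r u x -> x \in ball u r.
Proof.
case=> l [t [lr a]]; apply: (subsetP (ball_mono u lr)).
elim: a => [|l' v t' {}x s _ IH e sl _ _] /=; first by rewrite inE.
apply/bigcupP; exists v => //; rewrite in_star mem_filter mem_enum e andbT.
by apply/orP; right; apply/set0Pn; exists s.
Qed.

Lemma star_overflow u Y : 1 < k -> k.-1 ^ k.-1 < #|Y| ->
  (forall x, x \in Y -> within_steps G k.-1 u x) -> conn_ge true true.
Proof.
move=> k1 lY HY.
have [/existsP[v kv]|no] := boolP [exists v, k <= #|star v|].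
  by exists (star v); split=> //; exact: star_conn.
have small v : #|star v| <= k.-1.
  by move/existsPn: no => /(_ v); rewrite -ltnNge; lia.
have card r : #|ball u r| <= k.-1 ^ r.
  elim: r => [|r IH]; first by rewrite cards1.
  rewrite /= expnS mulnC.
  apply: leq_trans (card_bigcup_le (fun v _ => small v)) _.
  by rewrite leq_mul2r IH orbT.
have sub : Y \subset ball u k.-1.
  by apply/subsetP => x /HY; exact: within_steps_ball.
by have := subset_leq_card sub; have := card k.-1; lia.
Qed.

End Stars.

Lemma conn_overflow uni closed u : 1 < k ->
  overflow G (capacity tau k uni) (rounds tau k uni) (mask tau uni) u ->
  conn_ge uni closed.
Proof.
move=> k1 [Y [lY HY]].
suff [X [cX kX]] : conn_ge uni true by exists X; split=> //; exact: conn_open.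
case: uni lY HY => lY HY.
  exact: (star_overflow k1 lY (fun x xY => proj2 (HY x xY))).
exact: (snapshot_overflow lY (fun x xY => proj1 (HY x xY))).
Qed.

Section Completeness.

Variable closed : bool.
Let D X := if closed then X else [set: 'I_n].

Lemma sub_D X : X \subset D X.
Proof. by rewrite /D; case: closed. Qed.

Lemma dom_enum X : dom closed (enum X) = D X.
Proof. by rewrite /dom /D; case: closed => //; apply/setP => x; rewrite inE mem_enum. Qed.

Lemma complete_tcc K X : 0 < k -> conn false closed X -> k <= #|X| ->
  (forall u Y, (forall x, x \in Y -> near G K 0 u x) -> #|Y| <= K) ->
  exists u S, [/\ uniq S, forall x, x \in S -> near G K 0 u x, k <= size S,
    ~~ closed -> size S = k /\ u \in S &
    forall x y, x \in S -> y \in S -> short_pair G K false (dom closed S) x y].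
Proof.
move=> k0 cX kX few.
have short x y : x \in X -> y \in X -> exists l t, l <= K /\ arrives G 0 (D X) x l y t.
  move=> xX yX; have [l [t a]] := cX x y xX yX.
  have xD : x \in D X by apply: (subsetP (sub_D X)).
  have [p [ts [tp lp _ pD _]]] := arrives_path a xD.
  have [pK|pK] := leqP (size p) K.
    by exists (size p), (end_time ts); split=> //; rewrite -lp; exact: path_arrives.
  have uq : uniq (x :: take K p).
    case/and4P: tp => uq _ _ _.
    by apply: subseq_uniq uq; rewrite /= eqxx take_subseq.
  suff: size (x :: take K p) <= K by rewrite /= size_take pK ltnn.
  rewrite -(card_uniqP uq) -[X in X <= _]cardsE; apply: (few x) => z.
  rewrite inE => /mem_split [p1 [p2 [ep lz]]].
  have tp' : temporal_path G x (p1 ++ (p2 ++ drop K p)) ts by rewrite catA -ep cat_take_drop.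
  have [|t' a'] := prefix_arrives (X := setT) tp'; first by move=> ? _; rewrite inE.
  exists (size p1), t'; rewrite -lz; split=> //.
  have : size (take K p) <= K by rewrite size_take pK.
  by rewrite ep size_cat; lia.
have [u uX] : exists u, u \in X by apply/set0Pn; rewrite -card_gt0; apply: leq_trans kX; lia.
have nearX x y : x \in X -> y \in X -> near G K 0 x y.
  move=> xX yX; have [l [t [lK a]]] := short x y xX yX.
  by exists l, t; split=> //; apply: arrives_mono a => //; exact: subsetT.
have [cl|cl] := orP (orbN closed).
  exists u, (enum X); split; rewrite ?enum_uniq -?cardE //.
  - by move=> x; rewrite mem_enum; exact: nearX.
  - by rewrite cl.
  - by move=> x y; rewrite !mem_enum dom_enum; exact: short.
have uE : u \in enum X by rewrite mem_enum.
have sT : size (take k (enum X)) = k.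
  by rewrite size_takel // -cardE.
have TX x : x \in take k (enum X) -> x \in X by move/mem_take; rewrite mem_enum.
have [v vT] : exists v, v \in take k (enum X).
  by case: (take k (enum X)) sT k0 => [<- //|v s _ _]; exists v; exact: mem_head.
exists v, (take k (enum X)); split.
- by rewrite take_uniq ?enum_uniq.
- by move=> x /TX; exact: nearX (TX _ vT).
- by rewrite sT.
- by [].
move=> x y /TX xX /TX yX; rewrite /short_pair /linkable.
by have := short x y xX yX; rewrite /dom /D (negbTE cl).
Qed.

Lemma arrives_static_cons u x l y t (s : 'I_tau) :
  [set u; x] \in edges G -> s \in lab G [set u; x] ->
  arrives G tau setT x l y t -> exists t', arrives G tau setT u l.+1 y t'.
Proof.
move=> e sl; elim=> [|l' v t' z s' _ [t2 IH] e' sl' ts' _].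
  exists s; apply: ArrivesS (Arrives0 _ _ _ _) e sl _ (in_setT _); exact: leq0n.
exists s'; apply: ArrivesS (IH) e' sl' _ (in_setT _).
by have [->|] := arrives_time IH; lia.
Qed.

Lemma within_steps_sym r u x : within_steps G r u x -> within_steps G r x u.
Proof.
case=> l [t [lr a]]; suff [t' a'] : exists t', arrives G tau setT x l u t' by exists l, t'.
elim: a {lr} => [|l' v t' {}x s _ [t2 IH] e sl _ _]; first by exists 0; exact: Arrives0.
by apply: arrives_static_cons IH; rewrite setUC; [exact: e|exact: sl].
Qed.

Lemma complete_tucc X : 1 < k -> conn true closed X -> k <= #|X| ->
  exists u S, [/\ uniq S, forall x, x \in S -> near G k.-1 tau u x, k <= size S,
    ~~ closed -> size S = k /\ u \in S &
    forall x y, x \in S -> y \in S -> short_pair G k.-1 true (dom closed S) x y].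
Proof.
move=> k1 cX kX.
case: (classic (exists x p ts, [/\ temporal_path G x p ts, x \in X,
    {subset x :: p <= D X} & k.-1 <= size p])) => [[x [p [ts [tp xX pD kp]]]]|no].
  have [ts' tp' _] : exists2 ts', temporal_path G x (take k.-1 p) ts' &
      end_time ts' <= end_time ts.
    by apply: (temporal_path_take (q := drop k.-1 p)); rewrite cat_take_drop.
  have sp : size (take k.-1 p) = k.-1 by rewrite size_takel.
  have uq : uniq (x :: take k.-1 p) by case/and4P: tp'.
  exists x, (x :: take k.-1 p); split=> //.
  - move=> z /mem_split [p1 [p2 [ep lz]]].
    move: tp'; rewrite ep => /(prefix_arrives (X := setT)) [|t a].
      by move=> ? _; rewrite inE.
    exists (size p1), t; rewrite -lz; split; last exact: arrives_mono a.
    by rewrite -sp ep size_cat leq_addr.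
  - by rewrite /= sp; lia.
  - by move=> _; rewrite /= sp mem_head; split=> //; lia.
  move=> y z yp zp; rewrite /short_pair /linkable.
  have sub : [set z in x :: take k.-1 p] \subset dom closed (x :: take k.-1 p).
    by rewrite /dom; case: closed.
  have M a b : path_pair G [set z in x :: take k.-1 p] (size (take k.-1 p)) a b ->
      path_pair G (dom closed (x :: take k.-1 p)) (size (take k.-1 p)) a b.
    by move=> [l' [t [ll c]]]; exists l', t; split=> //; exact: arrives_mono c.
  by case: (path_linked tp' yp zp) => /M; rewrite /path_pair sp; [left|right].
have short x y : x \in X -> (exists l t, arrives G 0 (D X) x l y t) ->
    path_pair G (D X) k.-1 x y.
  move=> xX [l [t a]].
  have xD : x \in D X by apply: (subsetP (sub_D X)).
  have [p [ts [tp lp _ pD _]]] := arrives_path a xD.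
  exists (size p), (end_time ts); split; last by rewrite -lp; exact: path_arrives.
  rewrite leqNgt; apply/negP => lt; apply: no; exists x, p, ts; split=> //; exact: ltnW.
have [u uX] : exists u, u \in X by apply/set0Pn; rewrite -card_gt0; apply: leq_trans kX; lia.
have pairs x y : x \in X -> y \in X -> path_pair G (D X) k.-1 x y \/ path_pair G (D X) k.-1 y x.
  move=> xX yX; case: (cX x y xX yX) => H; [left|right]; exact: short H.
have static x y : path_pair G (D X) k.-1 x y -> within_steps G k.-1 x y.
  case=> l [t [lk a]]; exists l, t; split=> //; apply: arrives_mono a => //.
have nearX x y : x \in X -> y \in X -> near G k.-1 tau x y.
  by move=> xX yX; case: (pairs x y xX yX) => /static // /within_steps_sym.
have [cl|cl] := orP (orbN closed).
  exists u, (enum X); split; rewrite ?enum_uniq -?cardE //.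
  - by move=> x; rewrite mem_enum; exact: nearX.
  - by rewrite cl.
  - by move=> x y; rewrite !mem_enum dom_enum; exact: pairs.
have sT : size (take k (enum X)) = k.
  by rewrite size_takel // -cardE.
have TX x : x \in take k (enum X) -> x \in X by move/mem_take; rewrite mem_enum.
have [v vT] : exists v, v \in take k (enum X).
  by case: (take k (enum X)) sT k1 => [<- //|v s _ _]; exists v; exact: mem_head.
exists v, (take k (enum X)); split.
- by rewrite take_uniq ?enum_uniq.
- by move=> x /TX; exact: nearX (TX _ vT).
- by rewrite sT.
- by [].
move=> x y /TX xX /TX yX; rewrite /short_pair /linkable.
by have := pairs x y xX yX; rewrite /path_pair /dom /D (negbTE cl).
Qed.

End Completeness.

End Connected.

(** * Running times *)

Lemma bin_le_exp2 m b : 'C(m, b) <= 2 ^ m.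
Proof.
elim: m b => [|m IH] [|b]; rewrite ?bin0 ?bin0n ?expn_gt0 //.
by rewrite binS expnS mul2n -addnn leq_add.
Qed.

Lemma exp_le_exp2 b : exists C, forall x, x ^ b <= C * 2 ^ x.
Proof.
exists (b`! * 2 ^ b) => x.
rewrite -mulnA -expnD addnC.
apply: leq_trans (leq_mul (leqnn _) (bin_le_exp2 (x + b) b)).
rewrite mulnC bin_ffact; elim: b => // b IH.
by rewrite addnS ffactSS expnS leq_mul // -addnS leq_addr.
Qed.

Lemma bernoulli a t : 0 < a -> t * a.-1 <= a ^ t.
Proof.
move=> a0; elim: t => // t IH; rewrite expnS mulSn.
have : 0 < a ^ t by rewrite expn_gt0 a0.
by case: a a0 IH => // a _ /=; nia.
Qed.

Lemma leq_exp_base e a b : a <= b -> a ^ e <= b ^ e.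
Proof. by move=> ab; case: e => // e; rewrite leq_exp2r. Qed.

Section Bounds.

Variables (k K R : nat).
Hypotheses (k1 : 1 < k) (K0 : 0 < K) (RK : R <= K).

Lemma K_exp i j : i <= j -> K ^ i <= K ^ j.
Proof. by move=> le; rewrite leq_pexp2l. Qed.

Lemma bf_time_le : bf_time K R <= 29 * K ^ 3.
Proof.
rewrite /bf_time; have := K_exp (isT : 0 <= 3); have := K_exp (isT : 1 <= 3).
have := K_exp (isT : 2 <= 3); rewrite !expnS expn0 !muln1 => h2 h1 h0.
have : R * (K * (K * 14 + 7) + 2) <= K * (K * (K * 14 + 7) + 2) by rewrite leq_mul2r RK orbT.
nia.
Qed.

Lemma rows_time_le : rows_time K R <= 37 * K ^ 4.
Proof.
rewrite /rows_time; have := bf_time_le; have := K_exp (isT : 0 <= 4).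
have := K_exp (isT : 1 <= 3); have := K_exp (isT : 0 <= 3).
rewrite (expnS K 3) expn0 expn1; nia.
Qed.

Lemma cand_time_le : cand_time K R <= 39 * K ^ 4.
Proof.
rewrite /cand_time; have := bf_time_le; have := K_exp (isT : 0 <= 4).
have := K_exp (isT : 1 <= 4); have := K_exp (isT : 3 <= 4).
rewrite expn0 expn1; lia.
Qed.

Definition work closed := if closed then 2 ^ K * K ^ 4 else K ^ k.-1 * k ^ 2.

Lemma vertex_time_le closed :
  vertex_time k K R closed <= 100 * (K ^ 4 + (if k <= K then work closed else 0)).
Proof.
rewrite /vertex_time; have hc := cand_time_le; have hr := rows_time_le.
have h0 := K_exp (isT : 0 <= 4); have h1 := K_exp (isT : 1 <= 4).
have h2 := K_exp (isT : 2 <= 4); rewrite expn0 expn1 in h0 h1.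
case: (leqP k K) => kK; last by lia.
rewrite /search_time /branches /attempt_time /bound /work /select_time /check_time /next_time.
have eK c : c * (c * 5 + 3) = c ^ 2 * 5 + c * 3 by rewrite -mulnn; lia.
have sqk : k <= k ^ 2 by rewrite -mulnn leq_pmulr; lia.
rewrite eK; have hk : k * (K * 2 + 6) <= 8 * K ^ 2 by rewrite -mulnn; nia.
have hK : K * (K * 2 + 6) <= 8 * K ^ 2 by rewrite -mulnn; nia.
case: closed => /=.
  set a := (X in 2 ^ K * X.+1).
  have ha : a.+1 <= 79 * K ^ 4 by rewrite /a; lia.
  have : 2 ^ K * a.+1 <= 2 ^ K * (79 * K ^ 4) by rewrite leq_mul2l ha orbT.
  have : 1 * K ^ 4 <= 2 ^ K * K ^ 4 by rewrite leq_mul2r expn_gt0 orbT.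
  rewrite (mulnCA (2 ^ K) 79); set Z := 2 ^ K * K ^ 4; lia.
set a := (X in K ^ k.-1 * X.+1).
have ha : a.+1 <= 42 * k ^ 2 by rewrite /a; lia.
have : K ^ k.-1 * a.+1 <= K ^ k.-1 * (42 * k ^ 2) by rewrite leq_mul2l ha orbT.
rewrite (mulnCA (K ^ k.-1) 42); set Z := K ^ k.-1 * k ^ 2; lia.
Qed.

End Bounds.

Definition run_time n tau k uni closed :=
  if k <= 1 then 5 else main_time n tau k uni closed.

Lemma run_time_le uni closed n tau k f c : 0 < n -> 0 < k -> 0 < f -> 0 < c ->
  let K := capacity tau k uni in
  (1 < k -> expo tau k uni * k.-1 <= c * f /\ K ^ 4 <= c * f) ->
  (1 < k <= K -> work k K closed <= c * f) ->
  (run_time n tau k uni closed).+1 <= 234 * c * (f * n).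
Proof.
move=> n0 k0 f0 c0 K H1 H2; rewrite /run_time.
have cf : 0 < c * f by rewrite muln_gt0 c0.
have cfn : 0 < c * f * n by rewrite muln_gt0 cf.
have -> : 234 * c * (f * n) = 234 * (c * f * n) by rewrite -!mulnA.
case: (leqP k 1) => k1; first by lia.
have [He HK] := H1 k1.
have K0 : 0 < K by rewrite /K /capacity expn_gt0; lia.
have RK : rounds tau k uni <= K.
  rewrite /rounds /K /capacity /expo; case: uni {H1 H2 K He HK K0} => //.
  by case: k k0 k1 => // -[|k'] // _ _; rewrite -{1}[k'.+1]expn1 leq_pexp2l.
have := vertex_time_le k1 K0 RK closed.
set V := vertex_time _ _ _ _; rewrite /main_time -/K -/V => HV.
have {}HV : V <= 200 * (c * f).
  by move: HV; case: (leqP k K) => kK; [have := H2 _; rewrite k1 kK => /(_ isT)|]; lia.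
have A : n * (V + 7) <= 207 * (c * f * n).
  by rewrite mulnC mulnA leq_mul2r; apply/orP; right; lia.
have B : c * f <= c * f * n by rewrite leq_pmulr.
have C : expo tau k uni <= expo tau k uni * k.-1 by rewrite leq_pmulr //; lia.
have -> : expo tau k uni * (k.-1 * 2 + 4) = expo tau k uni * k.-1 * 2 + expo tau k uni * 4.
  by rewrite mulnDr mulnA.
by move: He A B C cfn; move: (c * f * n) (c * f) (_ * k.-1) (n * (V + 7)) => *; lia.
Qed.

(* If [k <= K = k.-1 ^ tau] then [1 < tau], which leaves a factor
   [k ^ tau >= k ^ 2] for testing a tuple. *)
Lemma tcc_time n tau k : 0 < n -> 0 < k ->
  (run_time n tau k false false).+1 <= 234 * 1 * (k ^ (k * tau) * n).
Proof.
move=> n0 k0; apply: run_time_le => //; rewrite ?expn_gt0 ?k0 //; rewrite /capacity /expo mul1n.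
  move=> k1; split.
    apply: leq_trans (bernoulli _ k0) _.
    by rewrite leq_pexp2l // leq_pmull.
  rewrite -expnM; case: (ltngtP k 3) => k3.
  - have -> : k = 2 by lia.
    by rewrite exp1n expn_gt0.
  - apply: leq_trans (_ : k ^ (tau * 4) <= _).
      by apply: leq_exp_base; exact: leq_pred.
    by rewrite leq_pexp2l // mulnC leq_mul2r k3 orbT.
  - rewrite k3 mulnC !expnM.
    by apply: leq_exp_base.
rewrite /work => /andP[k1 kK].
have t2 : 1 < tau.
  by case: tau kK => [|[|t]] //; rewrite ?expn0 ?expn1; lia.
apply: leq_trans (_ : k ^ (tau * k.-1) * k ^ tau <= _).
  rewrite leq_mul ?leq_pexp2l // -expnM.
  by apply: leq_exp_base; exact: leq_pred.
by rewrite -expnD leq_pexp2l // addnC -mulnS mulnC prednK.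
Qed.

Lemma tucc_time n tau k : 0 < n -> 0 < k ->
  (run_time n tau k true false).+1 <= 234 * 1 * (k ^ (k ^ 2) * n).
Proof.
move=> n0 k0; apply: run_time_le => //; rewrite ?expn_gt0 ?k0 //; rewrite /capacity /expo mul1n.
  move=> k1; split.
    apply: leq_trans (_ : k ^ 2 <= _); first by rewrite -mulnn leq_mul // leq_pred.
    by rewrite leq_pexp2l // -mulnn; lia.
  rewrite -expnM; apply: leq_trans (_ : k ^ (k.-1 * 4) <= _).
    by apply: leq_exp_base; exact: leq_pred.
  by rewrite leq_pexp2l // -mulnn; nia.
rewrite /work => /andP[k1 kK].
apply: leq_trans (_ : k ^ (k.-1 * k.-1) * k ^ 2 <= _).
  by rewrite leq_mul2r -expnM leq_exp_base ?leq_pred ?orbT.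
by rewrite -expnD leq_pexp2l // -mulnn; nia.
Qed.

Lemma closed_tcc_time : exists c, forall n tau k, 0 < n -> 0 < k ->
  (run_time n tau k false true).+1 <= 234 * c * (2 ^ (k ^ tau) * n).
Proof.
have [C4 H4] := exp_le_exp2 4; have [C8 H8] := exp_le_exp2 8.
exists (C4 + C8).+1 => n tau k n0 k0; apply: run_time_le => //; rewrite ?expn_gt0 //.
  rewrite /capacity /expo => k1; have Kk : k.-1 ^ tau <= k ^ tau.
    by apply: leq_exp_base; exact: leq_pred.
  split.
    apply: leq_trans (bernoulli _ k0) _; apply: leq_trans (ltnW (ltn_expl _ (isT : 1 < 2))) _.
    exact: leq_pmull.
  apply: leq_trans (H4 _) _; apply: leq_mul; first by lia.
  by rewrite leq_exp2l.
rewrite /work /capacity /expo => /andP[k1 kK].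
have k3 : 2 < k by case: k k1 kK {k0} => [|[|[|k]]] //; rewrite exp1n.
have [t et] : exists t, tau = t.+2.
  by case: tau kK => [|[|t]]; rewrite ?expn0 ?expn1; [lia|lia|exists t].
set x := k.-1 ^ t.+1.
have Kx : k.-1 ^ tau <= x ^ 2.
  by rewrite et /x -expnM leq_pexp2l //; lia.
have Kkx : k.-1 ^ tau + x <= k ^ tau.
  have xk : x <= k ^ t.+1 by apply: leq_exp_base; exact: leq_pred.
  by rewrite et expnS -/x [k ^ _]expnS addnC -mulSn prednK // leq_mul2l xk orbT.
apply: leq_trans (_ : 2 ^ (k.-1 ^ tau) * (C8 * 2 ^ x) <= _).
  rewrite leq_mul2l expn_eq0 /=; apply: leq_trans (H8 x).
  apply: leq_trans (_ : (x ^ 2) ^ 4 <= _); first by rewrite leq_exp2r.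
  by rewrite -expnM.
rewrite mulnCA -expnD; apply: leq_mul; first by lia.
by rewrite leq_exp2l.
Qed.

Lemma closed_tucc_time : exists c, forall n tau k, 0 < n -> 0 < k ->
  (run_time n tau k true true).+1 <= 234 * c * (2 ^ (k ^ k) * n).
Proof.
have [C4 H4] := exp_le_exp2 4.
exists C4.+1 => n tau k n0 k0; apply: run_time_le => //; rewrite ?expn_gt0 //.
  rewrite /capacity /expo => k1; have Kk : k.-1 ^ k.-1 <= k ^ k.
    apply: leq_trans (_ : k ^ k.-1 <= _); first by apply: leq_exp_base; exact: leq_pred.
    by rewrite leq_pexp2l // leq_pred.
  split.
    apply: leq_trans (_ : k * k.-1 <= _); first by rewrite leq_mul2r leq_pred orbT.
    apply: leq_trans (bernoulli _ k0) _; apply: leq_trans (ltnW (ltn_expl _ (isT : 1 < 2))) _.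
    exact: leq_pmull.
  apply: leq_trans (H4 _) _; apply: leq_mul; first by lia.
  by rewrite leq_exp2l.
rewrite /work /capacity /expo => /andP[k1 _].
have Kk : k.-1 ^ k.-1 + k.-1 ^ k.-1 <= k ^ k.
  have le : k.-1 ^ k.-1 <= k ^ k.-1 by apply: leq_exp_base; exact: leq_pred.
  apply: leq_trans (_ : 2 * k ^ k.-1 <= _); first by rewrite mul2n -addnn leq_add.
  by rewrite -[X in _ <= _ ^ X](prednK k0) expnS leq_mul2r k1 orbT.
apply: leq_trans (_ : 2 ^ (k.-1 ^ k.-1) * (C4 * 2 ^ (k.-1 ^ k.-1)) <= _).
  by rewrite leq_mul2l expn_eq0 /= H4.
rewrite mulnCA -expnD; apply: leq_mul; first by lia.
by rewrite leq_exp2l.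
Qed.

Lemma main_trivial_cost n tau (G : tgraph n tau) k uni closed : k <= 1 ->
  cost (encode G k) (main uni closed) linit <= 5.
Proof.
move=> k1.
have inp h i v : cell (encode G k) i v -> leval (encode G k) h (LInp (LCst i)) = v.
  by move=> c; apply: leval_inp.
suff [] : runs (encode G k) (main uni closed) linit 5 (fun=> True) by [].
do 3 apply: runs_set.
rewrite !(inp _ _ _ (cell_n G k), inp _ _ _ (cell_tau G k), inp _ _ _ (cell_k G k)).
by apply: runs_if => [|_]; [rewrite /= => H; lia|split].
Qed.

Lemma decidable_conn uni closed f c (P : forall n tau, tgraph n tau -> nat -> Prop) :
  (forall n tau (G : tgraph n tau) k, P n tau G k <-> conn_ge G k uni closed) ->
  (forall n tau k, 0 < n -> 0 < k ->
     (run_time n tau k uni closed).+1 <= c * (f n tau k * n)) ->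
  decidable_in_time_O P (fun n tau k => f n tau k * n).
Proof.
move=> PE time; exists (compile (main uni closed)), ((weight (main uni closed) + 6) * c).
move=> n tau G k k0.
have wfm : wf (main uni closed) by case: uni {PE time}; case: closed.
have [t [s [E T S]]] := compile_correct wfm (encode_end G k).
have trivial (k1 : k <= 1) := conn_trivial G uni closed k0 k1.
have complete (k1 : 1 < k) : conn_ge G k uni closed ->
    (forall u (Y : {set 'I_n}), (forall x, x \in Y ->
       near G (rounds tau k uni) (mask tau uni) u x) -> #|Y| <= capacity tau k uni) ->
    exists u S, [/\ uniq S,
      forall x, x \in S -> near G (rounds tau k uni) (mask tau uni) u x, k <= size S,
      ~~ closed -> size S = k /\ u \in S &
      forall x y, x \in S -> y \in S ->
        short_pair G (rounds tau k uni) uni (dom closed S) x y].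
  move=> [X [cX kX]]; case: uni {PE time wfm E T S trivial} cX => cX few.
    exact: (complete_tucc k1 cX kX).
  exact: (complete_tcc (K := capacity tau k false) k0 cX kX few).
have [cost_le ansE] := main_runs trivial (fun k1 u => @conn_overflow _ _ _ _ _ closed u k1)
  (@conn_found _ _ G k uni closed) complete.
exists t, s; split=> //; first by rewrite S PE.
move=> n0; apply: leq_trans T _; rewrite -mulnA leq_mul2l; apply/orP; right.
apply: leq_trans (time n tau k n0 k0); rewrite ltnS /run_time.
by case: (leqP k 1) => // k1; exact: main_trivial_cost.
Qed.

Theorem theorem8 :
  [/\ decidable_in_time_O has_TCC
        (fun n tau k : nat => k ^ (k * tau) * n),
      decidable_in_time_O has_closed_TCC
        (fun n tau k : nat => 2 ^ (k ^ tau) * n),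
      decidable_in_time_O has_TUCC
        (fun n tau k : nat => k ^ (k ^ 2) * n) &
      decidable_in_time_O has_closed_TUCC
        (fun n tau k : nat => 2 ^ (k ^ k) * n)].
Proof.
have [c2 time2] := closed_tcc_time; have [c4 time4] := closed_tucc_time.
split.
- exact: (decidable_conn (f := fun n tau k => k ^ (k * tau)) has_TCCE tcc_time).
- exact: (decidable_conn (f := fun n tau k => 2 ^ (k ^ tau)) has_closed_TCCE time2).
- exact: (decidable_conn (f := fun n tau k => k ^ (k ^ 2)) has_TUCCE tucc_time).
- exact: (decidable_conn (f := fun n tau k => 2 ^ (k ^ k)) has_closed_TUCCE time4).
Qed.
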